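(* Let $(\mathcal{E}_l)_{l\ge0}$ be a category of smooth objects over a field $K$, and let $\mathcal{E}_{n+m}$ have coordinates $(u,v)=(u_1,\ldots,u_n,v_1,\ldots,v_m)$. Let $\overline{T}$ be any normalized grading on $\mathbb{N}^n$, and let $f_{ij}(u,v)\in\mathcal{E}_{n+m}$ be a finite set of functions such that the initial exponents $\alpha_{ij}=\exp_{\overline T}(f_{ij}(u,0))$ are defined and generate a diagram $\Delta\subset\mathbb{N}^n$ of finite type, where $\alpha_{ij}\in\mathbb{N}^i\setminus\mathbb{N}^{i-1}$ and the $\alpha_{ij}$ are ordered reverse lexicographically, defining $\Gamma=\mathbb{N}^n\setminus\Delta$ and the decomposition of $\Delta$ into disjoint subsets $\Delta_{ij}=\alpha_{ij}+\Gamma_{ij}$. Then for any $g\in\mathcal{E}_{n+m}$ there exist $h_{ij}\in\mathcal{E}_{n+m}$ and $r(g)\in\mathcal{E}_{n+m}$ such that $$g=\sum h_{ij}f_{ij}+r(g),$$ where $\operatorname{supd}(h_{ij})\subset\Gamma_{ij}\times\mathbb{N}^m$ and $\operatorname{supd}(r(g))\subset\Gamma\times\mathbb{N}^m$. Moreover: 1. If $(\mathcal{E}_l)$ is reduced, the decomposition is unique. 2. If $\operatorname{ord}(f_{ij})=|\alpha_{ij}|$ then $\operatorname{ord}(h_{ij})\geq\operatorname{ord}(g)-|\alpha_{ij}|$. 3. If $\overline{T}$ is total then $\exp_{\overline T}(h_{ij}(u,0))+\alpha_{ij}\geq\exp_{\overline T}(g(u,0))$. 4. $\operatorname{ord}(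h_{ij}(u,0))\geq\operatorname{ord}(g(u,0))-|\alpha_{ij}|$.
   Context: **Category of smooth objects over a field $K$.** For each $n\ge0$ a triple $(\mathcal{E}_n,\{x_1,\ldots,x_n\},m_n)$ such that: (1) $\mathcal{E}_0=K$, $m_0=0$. (2) $\mathcal{E}_n$ is a local ring with maximal ideal $m_n$, containing its residue field $K$. (3) $x_i\in m_n$ and their classes form a basis of $m_n/m_n^2$ over $K$. (4) There is a $K$-algebra homomorphism $T_n:\mathcal{E}_n\to\varprojlim_k\mathcal{E}_n/m_n^k\simeq K[[x_1,\ldots,x_n]]$ with kernel $m_n^\infty=\bigcap_km_n^k$ and $x_i\mapsto x_i$. (5) Any $f_1,\ldots,f_m\in m_n$ define a unique ring homomorphism $f^*:\mathcal{E}_m\to\mathcal{E}_n$ with $f^*(x_i)=f_i$, commuting with the $T$'s (written $g\mapsto g(f_1,\ldots,f_m)$); $(x_1,\ldots,x_n)$ gives the identity, and compositions of such homomorphisms are again of this form. (6) There are derivations $\partial/\partial x_i$ of $\mathcal{E}_n$ commuting with $T_n$ and inducing the standard ones on $K[[x]]$ (in positive characteristic, Hasse derivatives commuting with $T_n$). (7) For $k\le n$ the functions $(x_1,\ldots,x_k)$ define an inclusion $\mathcal{E}_k\subset\mathcal{E}_n$ compatible with the $T$'s and the derivations, with $\mathcal{E}_k=\{f\in\mathcal{E}_n:\partial f/\partial x_i=0,\ i>k\}$ (all Hasse derivatives in $x_i$, $i>k$, in positive characteristic). (8) For $k\le n$, $(x_1,\ldots,x_k,0,\ldots,0)$ defines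 a surjection $\mathcal{E}_n\to\mathcal{E}_k$ with kernel $(x_{k+1},\ldots,x_n)$. (9) If $u_1,\ldots,u_n\in m_n$ and $\det[\partial u_i/\partial x_j](0)\ne0$, the map defined by $(u_1,\ldots,u_n)$ is invertible. (10) For $g(t,x)\in\mathcal{E}_{n+1}$ and $P^d=t^d+y_1t^{d-1}+\ldots+y_d\in\mathcal{E}_{n+d+1}(t,x,y)$ there are $h\in\mathcal{E}_{n+d+1}$ and $r_i\in\mathcal{E}_{n+d}(x,y)$ with $g=hP^d+\sum_{i=0}^{d-1}r_it^i$. The category is reduced if $m_n^\infty=0$ for all $n$. Examples: germs of $C^\infty$ functions at $0\in\mathbb{R}^n$; germs of real or complex analytic functions; henselizations of $K[x_1,\ldots,x_n]_{(x_1,\ldots,x_n)}$; $K[[x_1,\ldots,x_n]]$. **Orders.** A normalized grading on $\mathbb{N}^n$ is a tuple $\overline{T}=(T_1,\ldots,T_k)$ of linear forms on $\mathbb{R}^n$ with nonnegative coefficients with $T_1=x_1+\ldots+x_n$; it gives a (partial) order $\alpha\le\beta$ iff $\overline{T}(\alpha)\le_{\rm lex}\overline{T}(\beta)$. It is total if $\overline{T}:\mathbb{N}^n\to\mathbb{R}^k$ is injective. For $f$ with Taylor series $T_n(f)=\sum c_\alpha u^\alpha$, $\operatorname{supp}(f)=\{\alpha:c_\alpha\neq0\}$, and $\exp_{\overline T}(f)$ is the unique element of $\operatorname{supp}(f)$ at which $\overline{T}$ is lexicographically minimal, if it exists ($+\infty$ if the Taylor series is zero). $\operatorname{ord}(f)=\sup\{k:f\in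 m^k\}$. $f(u,0)$ is the restriction to $v=0$. $\operatorname{supd}(f)=\{\gamma\in\mathbb{N}^{n+m}:D_\gamma f\ne0\}$ with $D_\gamma=\frac1{\gamma!}\partial^{\gamma}$ the Hasse derivatives in $(u,v)$. $|\alpha|=\sum\alpha_i$. **Diagrams.** A diagram generated by finitely many $\alpha$'s is $\Delta=\bigcup(\alpha+\mathbb{N}^n)$. It is of finite type if for all $i<j$ and $\alpha\in\Delta$ there is $\alpha'_i\in\mathbb{N}$ such that replacing the $i$-th coordinate of $\alpha$ by $\alpha_i+\alpha_i'$ and the $j$-th by $0$ gives an element of $\Delta$. $\mathbb{N}^i$ is identified with $\mathbb{N}^i\times\{0\}\subset\mathbb{N}^n$. Reverse lexicographic order: $\alpha<_r\beta$ iff $(\alpha_n,\ldots,\alpha_1)<_{\rm lex}(\beta_n,\ldots,\beta_1)$. $\Delta_{ij}=(\alpha_{ij}+\mathbb{N}^n)\setminus\bigcup_{\alpha_{i'j'}<_r\alpha_{ij}}(\alpha_{i'j'}+\mathbb{N}^n)$ and $\Gamma_{ij}=\Delta_{ij}-\alpha_{ij}$.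
   Formalization: The derivatives are assumed to be an iterative (commuting) Hasse family with exact values on the coordinates, and axiom (7) is assumed for any choice of k coordinates; this is automatic in reduced categories, while with flat perturbations of the derivations the claim can fail. *)

(* Defs.v *)
(* mpoly must be imported before the extended reals: the other order is rejected
   because of clashing notation levels. *)
From HB Require Import structures.
From mathcomp Require Import all_boot all_order all_algebra.
From mathcomp Require Import ring_quotient.
From mathcomp Require Import mpoly.
From mathcomp Require Import boolp classical_sets reals constructive_ereal ereal.

Set Implicit Arguments.
Unset Strict Implicit.
Unset Printing Implicit Defensive.

Import Order.TTheory GRing.Theory.
Local Open Scope ring_scope.
Local Open Scope classical_set_scope.

(* The K-algebra K[[x_0, ..., x_{n-1}]]: a series is its family of
   coefficients, wrapped in a record so that it gets the Cauchy product and not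
   the pointwise one. *)
Record fps (K : comNzRingType) (n : nat) := Fps { fcoef : 'X_{1..n} -> K }.

HB.instance Definition _ (K : comNzRingType) n := gen_eqMixin (fps K n).
HB.instance Definition _ (K : comNzRingType) n := gen_choiceMixin (fps K n).

Section FpsRing.
Variables (K : comNzRingType) (n : nat).
Implicit Types (F G H : fps K n) (c : 'X_{1..n}).

Lemma fpsP F G : (forall c, fcoef F c = fcoef G c) -> F = G.
Proof. by case: F G => [F] [G] /= /funext ->. Qed.

Definition fps_zero : fps K n := Fps (fun=> 0).
Definition fps_one : fps K n := Fps (fun c => (c == 0%MM)%:R).
Definition fps_opp F : fps K n := Fps (fun c => - fcoef F c).
Definition fps_add F G : fps K n := Fps (fun c => fcoef F c + fcoef G c).
Definition fps_mul F G : fps K n := Fps (fun c =>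
  \sum_(k : 'X_{1..n < (mdeg c).+1, (mdeg c).+1} | c == (k.1 + k.2)%MM)
    fcoef F k.1 * fcoef G k.2).
Definition fps_scale (a : K) F : fps K n := Fps (fun c => a * fcoef F c).

Let trunc (d : nat) F : {mpoly K[n]} :=
  \sum_(c : 'X_{1..n < d}) fcoef F c *: 'X_[c].

Let truncE d F c : (mdeg c < d)%N -> (trunc d F)@_c = fcoef F c.
Proof. by move=> cd; rewrite /trunc mcoeff_mpoly. Qed.

Let trunc_mulE d F G c : (mdeg c < d)%N ->
  fcoef (fps_mul F G) c = (trunc d F * trunc d G)@_c.
Proof.
move=> cd; rewrite mcoeffM; apply: eq_bigr => k _.
by rewrite !truncE // (leq_trans (bmdeg _)).
Qed.

Fact fps_addA : associative fps_add.
Proof. by move=> F G H; apply: fpsP => c; rewrite /= addrA. Qed.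
Fact fps_addC : commutative fps_add.
Proof. by move=> F G; apply: fpsP => c; rewrite /= addrC. Qed.
Fact fps_add0 : left_id fps_zero fps_add.
Proof. by move=> F; apply: fpsP => c; rewrite /= add0r. Qed.
Fact fps_addN : left_inverse fps_zero fps_opp fps_add.
Proof. by move=> F; apply: fpsP => c; rewrite /= addNr. Qed.

HB.instance Definition _ := GRing.isZmodule.Build (fps K n)
  fps_addA fps_addC fps_add0 fps_addN.

Fact fps_mulA : associative fps_mul.
Proof.
move=> F G H; apply: fpsP => c; pose d := (mdeg c).+1.
transitivity (trunc d F * (trunc d G * trunc d H))@_c.
  rewrite mcoeffM; apply: eq_bigr => k _.
  by rewrite truncE ?bmdeg // (@trunc_mulE d) // bmdeg.
rewrite mulrA mcoeffM; apply: eq_bigr => k _.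
by rewrite [in RHS](@trunc_mulE d) ?bmdeg // truncE // bmdeg.
Qed.

Fact fps_mulC : commutative fps_mul.
Proof.
move=> F G; apply: fpsP => c.
by rewrite !(@trunc_mulE (mdeg c).+1) // mulrC.
Qed.

Fact fps_mul1 : left_id fps_one fps_mul.
Proof.
move=> F; apply: fpsP => c; pose d := (mdeg c).+1.
transitivity (1 * trunc d F)@_c; last by rewrite mul1r truncE.
rewrite mcoeffM; apply: eq_bigr => k _.
by rewrite truncE ?bmdeg // mcoeff1.
Qed.

Fact fps_mulDl : left_distributive fps_mul fps_add.
Proof.
move=> F G H; apply: fpsP => c; rewrite /= -big_split /=.
by apply: eq_bigr => k _; rewrite mulrDl.
Qed.

Fact fps_one_neq0 : fps_one != fps_zero.
Proof.
apply/eqP => /(congr1 (fun F : fps K n => fcoef F 0%MM)) /=.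
by rewrite eqxx => /eqP; rewrite oner_eq0.
Qed.

HB.instance Definition _ := GRing.Zmodule_isComNzRing.Build (fps K n)
  fps_mulA fps_mulC fps_mul1 fps_mulDl fps_one_neq0.

Fact fps_scaleA a b F : fps_scale a (fps_scale b F) = fps_scale (a * b) F.
Proof. by apply: fpsP => c; rewrite /= mulrA. Qed.
Fact fps_scale1 : left_id 1 fps_scale.
Proof. by move=> F; apply: fpsP => c; rewrite /= mul1r. Qed.
Fact fps_scaleDr : right_distributive fps_scale +%R.
Proof. by move=> a F G; apply: fpsP => c; rewrite /= mulrDr. Qed.
Fact fps_scaleDl F : {morph fps_scale^~ F : a b / a + b}.
Proof. by move=> a b; apply: fpsP => c; rewrite /= mulrDl. Qed.

HB.instance Definition _ := GRing.Zmodule_isLmodule.Build K (fps K n)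
  fps_scaleA fps_scale1 fps_scaleDr fps_scaleDl.

Fact fps_scaleAl (a : K) (F G : fps K n) : a *: (F * G) = (a *: F) * G.
Proof.
apply: fpsP => c; rewrite /= mulr_sumr.
by apply: eq_bigr => k _; rewrite mulrA.
Qed.

HB.instance Definition _ := GRing.Lmodule_isLalgebra.Build K (fps K n)
  fps_scaleAl.
HB.instance Definition _ := GRing.Lalgebra_isComAlgebra.Build K (fps K n).

End FpsRing.

Definition fps_var (K : comNzRingType) n (i : 'I_n) : fps K n :=
  Fps (fun c => (c == U_(i)%MM)%:R).

Definition mbinom n (a b : 'X_{1..n}) : nat := \prod_(i < n) 'C(a i, b i).

(* D_a (x ^ b) = binom(b, a) x ^ (b - a). *)
Definition fps_hasse (K : comNzRingType) n (a : 'X_{1..n}) (F : fps K n) :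
    fps K n :=
  Fps (fun c => fcoef F (c + a)%MM *+ mbinom (c + a)%MM a).

(* Formal substitution G(F_0, ..., F_{m-1}).  It is meaningful when the F_i have
   zero constant term, in which case only exponents b with |b| <= |c| contribute
   to the coefficient of x ^ c. *)
Definition fps_comp (K : comNzRingType) n m (G : fps K m)
    (F : 'I_m -> fps K n) : fps K n :=
  Fps (fun c => \sum_(b : 'X_{1..m < (mdeg c).+1})
    fcoef G b * fcoef (\prod_(i < m) F i ^+ b i) c).

Fixpoint ideal_exp (A : comNzRingType) (I : {pred A}) (k : nat) : set A :=
  if k is l.+1 then
    [set f | exists s : seq (A * A),
      (forall p, p \in s -> p.1 \in I /\ ideal_exp I l p.2)
      /\ f = \sum_(p <- s) p.1 * p.2]
  else setT.

(* [hasse a] is the Hasse derivative D_a; the derivation d/dx_i is D_{U_(i)}.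
   [pullback f] is f^*, relevant only when all the components of f lie in the
   maximal ideal (it is total to avoid a proof argument). *)
Record smooth_data (K : fieldType) := SmoothData {
  carrier :> nat -> comUnitAlgType K;
  maxid : forall n, {pred carrier n};
  coord : forall n, 'I_n -> carrier n;
  taylor : forall n, {lrmorphism carrier n -> fps K n};
  pullback : forall n m,
    ('I_m -> carrier n) -> {lrmorphism carrier m -> carrier n};
  hasse : forall n, 'X_{1..n} -> {linear carrier n -> carrier n}
}.

Arguments maxid {K} E n : rename.
Arguments coord {K} E {n} : rename.
Arguments taylor {K E n} : rename.
Arguments pullback {K E n m} : rename.
Arguments hasse {K E n} : rename.

Section SmoothData.
Variables (K : fieldType) (E : smooth_data K).

Definition at0 n (f : E n) : K := fcoef (taylor f) 0%MM.

Definition is_pullback n m (u : 'I_m -> E n)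
    (phi : {lrmorphism E m -> E n}) : Prop :=
  (forall i, phi (coord E i) = u i) /\
  (forall g, taylor (phi g)
     = fps_comp (taylor g) (fun i => taylor (u i))).

Definition incl k n (sigma : 'I_k -> 'I_n) : {lrmorphism E k -> E n} :=
  pullback (fun i => coord E (sigma i)).

(* Restriction f(u, v) |-> f(u, 0). *)
Definition restrict n m : {lrmorphism E (n + m)%N -> E n} :=
  pullback (fun i => match split i with inl j => coord E j | inr _ => 0 end).

Definition mnm_push k n (sigma : 'I_k -> 'I_n) (a : 'X_{1..k}) : 'X_{1..n} :=
  (\sum_(j < k) U_(sigma j) *+ a j)%MM.

(* P^d = t^d + y_1 t^(d-1) + ... + y_d in E_{1+n+d}(t, x, y), with coordinates
   in that order. *)
Definition generic_poly n d : E (n.+1 + d)%N :=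
  let t := coord E (lshift d (ord0 : 'I_n.+1)) in
  t ^+ d + \sum_(j < d) coord E (rshift n.+1 j) * t ^+ (d - j.+1).

Record smooth_category : Prop := SmoothCategory {
  sc_base : forall f : E 0, exists c : K, f = c%:A;
  sc_base_maxid : forall f : E 0, (f \in maxid E 0) = (f == 0);

  sc_ideal : forall n, idealr_closed (maxid E n);
  sc_local : forall n (f : E n), f \notin maxid E n -> f \is a GRing.unit;
  sc_residue : forall n (f : E n), exists c : K, f - c%:A \in maxid E n;

  sc_coord : forall n (i : 'I_n), coord E i \in maxid E n;
  sc_cotangent : forall n (f : E n), f \in maxid E n ->
    exists! c : 'rV[K]_n,
      ideal_exp (maxid E n) 2 (f - \sum_(i < n) c 0 i *: coord E i);

  sc_taylor_coord : forall n (i : 'I_n),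
    taylor (coord E i) = fps_var K i;
  sc_taylor_ker : forall n (f : E n),
    taylor f = 0 <-> forall k, ideal_exp (maxid E n) k f;
  (* T_n induces E_n / m_n^k = K[[x]] / (x)^k, that is, it is the canonical map
     to the completion. *)
  sc_taylor_exp : forall n k (f : E n),
    ideal_exp (maxid E n) k f <->
    forall c : 'X_{1..n}, (mdeg c < k)%N -> fcoef (taylor f) c = 0;

  sc_pullback : forall n m (u : 'I_m -> E n),
    (forall i, u i \in maxid E n) -> is_pullback u (pullback u);
  sc_pullback_unique : forall n m (u : 'I_m -> E n),
    (forall i, u i \in maxid E n) ->
    forall phi : {lrmorphism E m -> E n},
      is_pullback u phi -> phi =1 pullback u;
  sc_pullback_id : forall n, pullback (fun i : 'I_n => coord E i) =1 id;
  sc_pullback_comp : forall n m l (u : 'I_m -> E n) (w : 'I_l -> E m),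
    (forall i, u i \in maxid E n) -> (forall i, w i \in maxid E m) ->
    pullback u \o pullback w =1 pullback (fun i => pullback u (w i));

  (* The next four laws make [hasse] an iterative family of Hasse derivatives
     for the coordinates; in characteristic zero they amount to commuting
     derivations d_i = D_{U_(i)} with d_i x_j = delta_ij, and force
     D_a = d^a / a!. *)
  sc_hasse0 : forall n (f : E n), hasse 0%MM f = f;
  sc_hasseM : forall n (a : 'X_{1..n}) (f g : E n),
    hasse a (f * g) =
    \sum_(k : 'X_{1..n < (mdeg a).+1, (mdeg a).+1} | a == (k.1 + k.2)%MM)
      hasse k.1 f * hasse k.2 g;
  sc_hasse_iter : forall n (a b : 'X_{1..n}) (f : E n),
    hasse a (hasse b f) = hasse (a + b)%MM f *+ mbinom (a + b)%MM a;
  sc_hasse_coord : forall n (a : 'X_{1..n}) (j : 'I_n), a != 0%MM ->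
    hasse a (coord E j) = (a == U_(j)%MM)%:R;
  sc_hasse_taylor : forall n (a : 'X_{1..n}) (f : E n),
    taylor (hasse a f) = fps_hasse a (taylor f);

  (* Any k of the n coordinates, in any order, define an inclusion; the case of
     the first k coordinates is [sigma := widen_ord _].  The general case gives
     a meaning to inclusions such as E(x, y) in E(t, x, y).  In characteristic
     zero, the last condition of [sc_incl_image] reduces to e = 1. *)
  sc_incl_inj : forall k n (sigma : 'I_k -> 'I_n), injective sigma ->
    injective (incl sigma);
  sc_incl_hasse : forall k n (sigma : 'I_k -> 'I_n), injective sigma ->
    forall (a : 'X_{1..k}) (f : E k),
      hasse (mnm_push sigma a) (incl sigma f) = incl sigma (hasse a f);
  sc_incl_image : forall k n (sigma : 'I_k -> 'I_n), injective sigma ->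
    forall f : E n,
      (exists g : E k, f = incl sigma g) <->
      (forall (i : 'I_n) (e : nat), (forall j, sigma j != i) -> (0 < e)%N ->
         hasse (U_(i) *+ e)%MM f = 0);

  sc_restrict_surj : forall k l (g : E k), exists f, restrict k l f = g;
  sc_restrict_ker : forall k l (f : E (k + l)%N),
    restrict k l f = 0 <->
    exists a : 'I_l -> E (k + l)%N,
      f = \sum_(i < l) a i * coord E (rshift k i);

  sc_inverse : forall n (u : 'I_n -> E n), (forall i, u i \in maxid E n) ->
    \det (\matrix_(i < n, j < n) at0 (hasse U_(j)%MM (u i))) != 0 ->
    exists2 w : 'I_n -> E n, (forall i, w i \in maxid E n) &
      cancel (pullback u) (pullback w) /\
      cancel (pullback w) (pullback u);

  sc_division : forall n d (g : E n.+1),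
    exists (h : E (n.+1 + d)%N) (r : 'I_d -> E (n + d)%N),
      incl (lshift d) g = h * generic_poly n d +
        \sum_(i < d) incl (lift (ord0 : 'I_(n + d).+1)) (r i)
                     * coord E (lshift d (ord0 : 'I_n.+1)) ^+ i
}.

Definition reduced : Prop :=
  forall n (f : E n), (forall k, ideal_exp (maxid E n) k f) -> f = 0.

Definition supp n (f : E n) : set 'X_{1..n} :=
  [set a | fcoef (taylor f) a != 0].

Definition supd n (f : E n) : set 'X_{1..n} := [set a | hasse a f != 0].

(* sup {k | f in m^k}, in the extended reals *)
Definition ord (R : realType) n (f : E n) : \bar R :=
  ereal_sup [set (k%:R)%:E | k in [set k | ideal_exp (maxid E n) k f]].

End SmoothData.

Section Gradings.
Variables (R : realType) (k n : nat) (T : 'M[R]_(k.+1, n)).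

(* Row i of the matrix T holds the coefficients of the linear form T_{i+1}. *)
Definition normalized_grading : Prop :=
  (forall i j, 0 <= T i j) /\ (forall j, T ord0 j = 1).

Definition grade (a : 'X_{1..n}) : k.+1.-tuplelexi R :=
  [tuple \sum_(j < n) T i j * (a j)%:R | i < k.+1].

Definition total_grading : Prop := injective grade.

(* exp_T(f) = e, where [None] stands for +oo; this does not hold for any e when
   the initial exponent is undefined. *)
Definition is_exp (K : fieldType) (E : smooth_data K) (f : E n)
    (e : option 'X_{1..n}) : Prop :=
  match e with
  | Some a => supp f a /\
      forall b, supp f b -> b <> a -> (grade a < grade b)%O
  | None => supp f = set0
  end.

Definition exp_le (a b : option 'X_{1..n}) : Prop :=
  match a, b with
  | _, None => True
  | None, Some _ => False
  | Some a, Some b => (grade a <= grade b)%O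
  end.

End Gradings.

Section Diagrams.
Variable n : nat.
Implicit Types (a b c : 'X_{1..n}) (D : set 'X_{1..n}).

(* a belongs to N^i = N^i x {0}. *)
Definition in_Npow (i : nat) a : Prop := forall l : 'I_n, (i <= l)%N -> a l = 0%N.

(* a belongs to N^i \ N^{i-1}, with N^{-1} empty. *)
Definition at_level (i : nat) a : Prop :=
  in_Npow i a /\ ((0 < i)%N -> ~ in_Npow i.-1 a).

Definition mrev a : n.-tuplelexi nat := [tuple a (rev_ord i) | i < n].

Definition revlex_lt a b : Prop := (mrev a < mrev b)%O.

Definition finite_type D : Prop :=
  forall (i j : 'I_n) a, (i < j)%N -> D a ->
  exists e : nat,
    D [multinom (if l == i then a i + e else if l == j then 0 else a l)%N
      | l < n].

Variables (s : 'I_n.+1 -> nat) (alpha : forall i, 'I_(s i) -> 'X_{1..n}).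

Definition diagram : set 'X_{1..n} :=
  [set b | exists i (j : 'I_(s i)), (alpha j <= b)%MM].

Definition Gamma : set 'X_{1..n} := ~` diagram.

Definition Delta_ij i (j : 'I_(s i)) : set 'X_{1..n} :=
  [set b | (alpha j <= b)%MM /\
    forall i' (j' : 'I_(s i')), revlex_lt (alpha j') (alpha j) ->
      ~~ (alpha j' <= b)%MM].

Definition Gamma_ij i (j : 'I_(s i)) : set 'X_{1..n} :=
  [set c | Delta_ij j (alpha j + c)%MM].

End Diagrams.

(* D x N^m *)
Definition cylinder n m (D : set 'X_{1..n}) : set 'X_{1..n + m} :=
  [set c | D [multinom c (lshift m i) | i < n]].

Definition is_decomposition (K : fieldType) (E : smooth_data K) n m
    (s : 'I_n.+1 -> nat) (f : forall i, 'I_(s i) -> E (n + m)%N)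
    (alpha : forall i, 'I_(s i) -> 'X_{1..n}) (g : E (n + m)%N)
    (h : forall i, 'I_(s i) -> E (n + m)%N) (r : E (n + m)%N) : Prop :=
  [/\ g = \sum_(i < n.+1) \sum_(j < s i) h i j * f i j + r,
      forall i (j : 'I_(s i)), supd (h i j) `<=` cylinder (Gamma_ij alpha j)
    & supd r `<=` cylinder (Gamma alpha)].

(* Main.v *)
From Pilot Require Import Defs.
From HB Require Import structures.
From mathcomp Require Import all_boot all_order all_algebra.
From mathcomp Require Import mpoly zify.
From mathcomp Require Import boolp classical_sets reals constructive_ereal ereal.

Set Implicit Arguments.
Unset Strict Implicit.
Unset Printing Implicit Defensive.

Import Order.TTheory GRing.Theory.
Import Pilot.Defs.
Local Open Scope ring_scope.
Local Open Scope classical_set_scope.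

(** The theorem is a Weierstrass division carried out one variable at a time, with
    several divisors at once.

    Formal estimates. Give the exponents a weight for which [alpha x] is the
    leading exponent of [f x]. In a decomposition [g = sum h_x f_x + r] the leading
    terms of the products [h_x f_x] and the terms of [r] sit at distinct exponents,
    because the sectors and the complement of the diagram are disjoint, and so they
    cannot cancel: every upper set of weights containing the support of [g] contains
    those of [r] and of the [u ^ alpha_x h_x] ([division_weights]). Suitable weights
    and upper sets give the uniqueness of the Taylor series of [h] and [r], hence
    uniqueness in the reduced case, and all the estimates.

    Weierstrass division. Let [f (t, x)] have order [d] in [t]. Dividing [f] by the
    generic monic polynomial of degree [d] and solving the equations that make the
    remainder vanish, by the inverse function theorem, factors [f] as a unit times a
    polynomial, and the division axiom gives division by [f]
    ([weierstrass_division]). For a square matrix [F] whose rows at [x = 0] have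
    leading terms [t ^ (c a) e_a] there is a division of vectors with remainders of
    degree less than [c y] in the component [y] ([matrix_weierstrass_division]): the
    vectors modulo the rows of [F] form a finite module over the germs in [x],
    by division by the determinant, and Nakayama's lemma reduces its generation to
    the case [x = 0], where leading terms are reduced finitely many times and flat
    germs are absorbed by a power of [t].

    Existence. After division by the generators in the first [p] variables, the
    remainder is supported over exponents [b] in N^p outside the diagram. Finite
    type implies that only finitely many of them, the frontier, lie below a point of
    the diagram reached in the direction [p] ([frontier_bounded]). The coefficients
    of the remainder at the frontier form a vector of germs in the later variables,
    and at the point where the diagram is entered above a frontier exponent sits the
    initial exponent of a monomial multiple of one generator. Reduced by the earlier
    generators, these multiples are the rows of a square matrix, and
    [division_weights] shows that its leading terms are diagonal. Dividing by this
    matrix gives the division by the generators in the first [p + 1] variables ([partial_divisionS]). *)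

(** * Exponents and formal power series *)

Section Exponents.
Context {n : nat}.
Implicit Types a b c : 'X_{1..n}.

Lemma mbinom_disjoint a b : (forall i, a i = 0%N \/ b i = 0%N) ->
  mbinom (a + b)%MM a = 1%N.
Proof.
move=> ab; apply: big1 => i _; rewrite mnmDE.
by case: (ab i) => ->; rewrite ?bin0 // addn0 binn.
Qed.

Lemma mbinomnn a : mbinom a a = 1%N.
Proof. by apply: big1 => i _; rewrite binn. Qed.

Definition trunc (p : nat) a : 'X_{1..n} :=
  [multinom if (i < p)%N then a i else 0%N | i < n].

Lemma truncE p a i : trunc p a i = if (i < p)%N then a i else 0%N.
Proof. exact: mnmE. Qed.

Lemma trunc_le p a : (trunc p a <= a)%MM.
Proof. by apply/mnm_lepP => i; rewrite truncE; case: ifP. Qed.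

Lemma truncS p a b : (a <= b)%MM -> (trunc p a <= trunc p b)%MM.
Proof.
by move=> /mnm_lepP ab; apply/mnm_lepP => i; rewrite !truncE; case: ifP.
Qed.

Lemma truncD p a b : trunc p (a + b)%MM = (trunc p a + trunc p b)%MM.
Proof.
by apply/mnmP => i; rewrite mnmDE !truncE mnmDE; case: ifP; rewrite ?addn0.
Qed.

Lemma lepm_add a b c d : (a <= b)%MM -> (c <= d)%MM -> (a + c <= b + d)%MM.
Proof.
move=> /mnm_lepP ab /mnm_lepP cd; apply/mnm_lepP => i.
by rewrite !mnmDE leq_add.
Qed.

Lemma trunc_Npow p a : in_Npow p a <-> trunc p a = a.
Proof.
split=> [h|<-] ; last by move=> i pi; rewrite truncE ltnNge pi.
by apply/mnmP => i; rewrite truncE; case: ltnP => // /h.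
Qed.

Lemma in_Npow_trunc p a : in_Npow p (trunc p a).
Proof. by move=> i pi; rewrite truncE ltnNge pi. Qed.

Lemma in_Npow_le p a b : (a <= b)%MM -> in_Npow p b -> in_Npow p a.
Proof.
by move=> /mnm_lepP ab bp i /bp bi; apply/eqP; rewrite -leqn0 -bi ab.
Qed.

Lemma in_Npow_leq p q a : (p <= q)%N -> in_Npow p a -> in_Npow q a.
Proof. by move=> pq ha i qi; apply: ha; apply: leq_trans qi. Qed.

Lemma mnm1nE (i j : 'I_n) k : (U_(i) *+ k)%MM j = if i == j then k else 0%N.
Proof. by rewrite mulmnE mnm1E; case: (i == j); rewrite ?mul1n ?mul0n. Qed.

Lemma trunc0_eq0 a : trunc 0 a = 0%MM.
Proof. by apply/mnmP => i; rewrite [LHS]truncE mnm0E. Qed.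

Lemma trunc_ge p a : (n <= p)%N -> trunc p a = a.
Proof.
by move=> np; apply/mnmP => i; rewrite truncE (leq_trans (ltn_ord i) np).
Qed.

Lemma truncS_split (p : 'I_n) a :
  trunc p.+1 a = (trunc p a + U_(p) *+ a p)%MM.
Proof.
apply/mnmP => i; rewrite mnmDE !truncE mnm1nE ltnS leq_eqVlt.
case: eqVneq => [/val_inj->|ne] /=; first by rewrite ltnn eqxx.
by rewrite eq_sym -(inj_eq val_inj) /= (negPf ne) addn0.
Qed.

End Exponents.

Section FpsMonomials.
Context {K : comNzRingType} {n : nat}.
Implicit Types (a b c : 'X_{1..n}) (F : fps K n).

Definition fps_mono a : fps K n := Fps (fun c => (c == a)%:R).

Lemma fcoefM_mono F a c :
  fcoef (F * fps_mono a) c = if (a <= c)%MM then fcoef F (c - a)%MM else 0.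
Proof.
case: ifP => [ac|nac]; last first.
  apply: big1 => -[k1 k2] /= /eqP ck; case: eqVneq => [ka|_]; last exact: mulr0.
  by case/negP: (negbT nac); rewrite {1}ck -ka lem_addl.
have b1 : (mdeg (c - a)%MM < (mdeg c).+1)%N by rewrite ltnS mdegB.
have b2 : (mdeg a < (mdeg c).+1)%N by rewrite ltnS -(submK ac) mdegD leq_addl.
rewrite /= (bigD1 (BMultinom b1, BMultinom b2)) /=; last by rewrite submK.
rewrite eqxx mulr1 big1 ?addr0 // => -[k1 k2] /= /andP[/eqP ck ne].
case: eqVneq => [ka|_]; last exact: mulr0.
have kE : (k1 = c - a :> 'X_{1..n})%MM by rewrite -ka -(addmK k2 k1) -ck.
by case/negP: ne; apply/eqP; congr pair; apply: val_inj.
Qed.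

Lemma fps_monoM a b : fps_mono a * fps_mono b = fps_mono (a + b)%MM.
Proof.
apply: fpsP => c; rewrite fcoefM_mono /=; case: ifP => [bc|nbc].
  by congr (_%:R); congr nat_of_bool; apply/eqP/eqP => [<-|->]; rewrite ?submK ?addmK.
by case: eqVneq => // cab; rewrite cab lem_addl in nbc.
Qed.

Lemma fps_varE i : fps_var K i = fps_mono U_(i)%MM.
Proof. by []. Qed.

Lemma fps_monoX a k : fps_mono a ^+ k = fps_mono (a *+ k)%MM.
Proof.
elim: k => [|k IH]; first by rewrite expr0 mulm0n.
by rewrite exprS IH fps_monoM mulmS.
Qed.

Lemma fps_mono_prod (I : Type) (r : seq I) (A : I -> 'X_{1..n}) :
  \prod_(i <- r) fps_mono (A i) = fps_mono (\sum_(i <- r) A i)%MM.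
Proof. by elim/big_rec2: _ => // i x _ _ ->; rewrite fps_monoM. Qed.

End FpsMonomials.

(** * Coefficients in a category of smooth objects *)

Section Coefficients.
Context {K : fieldType} {E : smooth_data K}.

Definition coeff n (f : E n) (a : 'X_{1..n}) : K := fcoef (taylor f) a.
Definition monom n (a : 'X_{1..n}) : E n := \prod_(i < n) coord E i ^+ a i.

Section Linear.
Context {n : nat}.
Implicit Types (f g : E n) (a b c : 'X_{1..n}).

Lemma coeff0 a : coeff (0 : E n) a = 0.
Proof. by rewrite /coeff raddf0. Qed.
Lemma coeffD f g a : coeff (f + g) a = coeff f a + coeff g a.
Proof. by rewrite /coeff raddfD. Qed.
Lemma coeffN f a : coeff (- f) a = - coeff f a.
Proof. by rewrite /coeff raddfN. Qed.
Lemma coeffB f g a : coeff (f - g) a = coeff f a - coeff g a.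
Proof. by rewrite coeffD coeffN. Qed.
Lemma coeffZ (l : K) f a : coeff (l *: f) a = l * coeff f a.
Proof. by rewrite /coeff linearZ. Qed.
Lemma coeff_sum (I : Type) (r : seq I) P (F : I -> E n) a :
  coeff (\sum_(i <- r | P i) F i) a = \sum_(i <- r | P i) coeff (F i) a.
Proof. by elim/big_rec2: _ => [|i x y _ <-]; rewrite (coeff0, coeffD). Qed.
Lemma coeff1 a : coeff (1 : E n) a = (a == 0%MM)%:R.
Proof. by rewrite /coeff rmorph1. Qed.

Lemma taylorM f g : taylor (f * g) = taylor f * taylor g.
Proof. exact: rmorphM. Qed.

Lemma coeffM f g c : coeff (f * g) c =
  \sum_(k : 'X_{1..n < (mdeg c).+1, (mdeg c).+1} | c == (k.1 + k.2)%MM)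
    coeff f k.1 * coeff g k.2.
Proof. by rewrite /coeff rmorphM. Qed.

Lemma at0_is_zmod_morphism : zmod_morphism (@at0 K E n).
Proof. by move=> f g; exact: coeffB. Qed.
Lemma at0_is_monoid_morphism : monoid_morphism (@at0 K E n).
Proof.
split=> [|f g]; first by rewrite /at0 rmorph1 /= eqxx.
rewrite -[LHS]/(coeff (f * g) 0%MM) coeffM.
have b0 : (mdeg (0%MM : 'X_{1..n}) < (mdeg (0%MM : 'X_{1..n})).+1)%N by [].
rewrite (bigD1 (BMultinom b0, BMultinom b0)) /= ?addm0 // big1 ?addr0 //.
move=> -[k1 k2] /= /andP[/eqP ck]; rewrite xpair_eqE -!val_eqE /=.
by move/esym/eqP: ck; rewrite mnmD_eq0 => ->.
Qed.

HB.instance Definition _ := GRing.isZmodMorphism.Build (E n) K (@at0 K E n)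
  at0_is_zmod_morphism.
HB.instance Definition _ := GRing.isMonoidMorphism.Build (E n) K (@at0 K E n)
  at0_is_monoid_morphism.

Lemma at0E f : at0 f = coeff f 0%MM.
Proof. by []. Qed.
End Linear.

Hypothesis hE : smooth_category E.

Section Category.
Context {n : nat}.
Implicit Types (f g : E n) (a b c : 'X_{1..n}).

Lemma taylor_monom a : taylor (monom a) = fps_mono a :> fps K n.
Proof.
rewrite rmorph_prod; under eq_bigr => i _.
  rewrite rmorphXn /= sc_taylor_coord // fps_varE fps_monoX; over.
by rewrite fps_mono_prod -multinomUE_id.
Qed.

Lemma coeff_monom a c : coeff (monom a) c = (c == a)%:R.
Proof. by rewrite /coeff taylor_monom. Qed.

Lemma coeff_mul_monom f a c :
  coeff (f * monom a) c = if (a <= c)%MM then coeff f (c - a)%MM else 0.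
Proof. by rewrite /coeff taylorM taylor_monom fcoefM_mono. Qed.

Lemma monomD a b : monom (a + b)%MM = monom a * monom b :> E n.
Proof.
by rewrite /monom -big_split /=; apply: eq_bigr => i _; rewrite mnmDE exprD.
Qed.

Lemma monomUn (i : 'I_n) k : monom (U_(i) *+ k)%MM = coord E i ^+ k.
Proof.
rewrite /monom (bigD1 i) //= mnm1nE eqxx big1 ?mulr1 // => j.
by rewrite eq_sym mnm1nE => /negPf ->.
Qed.

Lemma monomU (i : 'I_n) : monom U_(i)%MM = coord E i.
Proof. by rewrite -[U_(i)%MM]mulm1n monomUn. Qed.

Lemma coeff_hasse f a : coeff f a = at0 (hasse a f).
Proof.
rewrite /at0 (sc_hasse_taylor hE) /= -[X in (X + a)%MM]/(0%MM : 'X_{1..n}).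
by rewrite addmC addm0 mbinomnn mulr1n.
Qed.

(** The first power of the maximal ideal is the ideal itself, so the comparison
    of its powers with the orders of Taylor series reads membership on the
    constant term. *)
Lemma maxidE f : (f \in maxid E n) = (at0 f == 0).
Proof.
have [id0 id1 idM] := sc_ideal hE n.
have idD u v : u \in maxid E n -> v \in maxid E n -> u + v \in maxid E n.
  by move=> hu hv; rewrite -[u]mul1r idM.
apply/idP/eqP => [fm|f0].
  apply: ((sc_taylor_exp hE 1 f).1 _ 0%MM); last by rewrite mdeg0.
  exists [:: (f, 1)].
  by split; [move=> p /[!inE] /eqP -> | rewrite big_seq1 mulr1].
have [|s [sm ->]] := (sc_taylor_exp hE 1 f).2.
  move=> c; rewrite ltnS leqn0 mdeg_eq0 => /eqP -> //.
rewrite big_seq; elim/big_ind: _ => // p /sm[pm _].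
by rewrite mulrC -[_ * _]addr0 idM.
Qed.

Lemma at0_unit f : at0 f != 0 -> f \is a GRing.unit.
Proof. by move=> f0; apply: (sc_local hE); rewrite maxidE. Qed.

Lemma at0_coord (i : 'I_n) : at0 (coord E i) = 0.
Proof. by apply/eqP; rewrite -maxidE (sc_coord hE). Qed.

End Category.

Lemma pullback_coord n m (u : 'I_m -> E n) i : (forall i, at0 (u i) = 0) ->
  pullback u (coord E i) = u i.
Proof.
move=> u0; apply: (sc_pullback hE _).1 => j; by rewrite maxidE // u0.
Qed.

Lemma taylor_pullback n m (u : 'I_m -> E n) g : (forall i, at0 (u i) = 0) ->
  taylor (pullback u g) = fps_comp (taylor g) (fun i => taylor (u i)).
Proof.
by move=> u0; apply: (sc_pullback hE _).2 => j; rewrite maxidE // u0.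
Qed.

Lemma at0_pullback n m (u : 'I_m -> E n) g : (forall i, at0 (u i) = 0) ->
  at0 (pullback u g) = at0 g.
Proof.
move=> u0; rewrite /at0 taylor_pullback //=.
rewrite (bigD1 bm0) //= [X in _ + X]big1 => [|b nb0]; last first.
  case/negP: nb0; rewrite -val_eqE /= -mdeg_eq0 -leqn0 -ltnS.
  by rewrite (leq_trans (bmdeg b)) // mdeg0.
rewrite addr0 big1 /= ?eqxx ?mulr1 // => i _.
by rewrite mnm0E expr0.
Qed.

(** Since an index with [sigma i = None] is sent to zero, only the monomials in
    the remaining coordinates survive. *)
Lemma coeff_pullback_coord n m (sigma : 'I_m -> option 'I_n) (g : E m) c :
  coeff (pullback (fun i => if sigma i is Some j then coord E j else 0) g) c =
  \sum_(b : 'X_{1..m < (mdeg c).+1} |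
        [forall i, (sigma i == None) ==> (b i == 0%N)] &&
        (c == \sum_(i < m) (if sigma i is Some j then U_(j) *+ b i else 0))%MM)
    coeff g b.
Proof.
rewrite /coeff taylor_pullback => [|i]; last first.
  by case: (sigma i) => [j|]; rewrite ?at0_coord // raddf0.
rewrite /= big_mkcond [RHS]big_mkcond; apply: eq_bigr => b _ /=.
case: ifP => [/andP[/forallP b0 cE]|nb]; last first.
  case: (boolP [forall i, _]) nb => /= [/forallP b0 ncE|/forallPn[i]].
    rewrite (eq_bigr (fun i => fps_mono
      (if sigma i is Some j then U_(j) *+ b i else 0)%MM)) => [|i _].
      by rewrite fps_mono_prod /= ncE mulr0.
    case: (sigma i) (b0 i) => [j _|/= /eqP ->]; last by rewrite expr0.
    by rewrite sc_taylor_coord // fps_varE fps_monoX.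
  rewrite negb_imply => /andP[/eqP si bi _].
  rewrite [X in fcoef X c](_ : _ = 0); first exact: mulr0.
  by rewrite (bigD1 i) //= si raddf0 expr0n (negPf bi) mul0r.
rewrite (eq_bigr (fun i => fps_mono
  (if sigma i is Some j then U_(j) *+ b i else 0)%MM)) => [|i _].
  by rewrite fps_mono_prod /= cE mulr1.
case: (sigma i) (b0 i) => [j _|/= /eqP ->]; last by rewrite expr0.
by rewrite sc_taylor_coord // fps_varE fps_monoX.
Qed.

End Coefficients.

(** * Restriction, inclusions and Hasse derivatives *)

Section Restriction.
Context {K : fieldType} {E : smooth_data K} (hE : smooth_category E).

(** Exponents of [(u, v)] are cut into their [u] and [v] parts; [lext] is the
    inclusion of N^n in N^(n + m). *)
Definition lpart n m (c : 'X_{1..n + m}) : 'X_{1..n} :=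
  [multinom c (lshift m i) | i < n].
Definition rpart n m (c : 'X_{1..n + m}) : 'X_{1..m} :=
  [multinom c (rshift n i) | i < m].

Definition lext n m (a : 'X_{1..n}) : 'X_{1..n + m} :=
  [multinom (if split i is inl j then a j else 0%N) | i < n + m].

Lemma lextE n m (a : 'X_{1..n}) (i : 'I_(n + m)) :
  lext m a i = if split i is inl j then a j else 0%N.
Proof. exact: mnmE. Qed.
Lemma lext_l n m (a : 'X_{1..n}) j : lext m a (lshift m j) = a j.
Proof. by rewrite lextE (unsplitK (inl j)). Qed.
Lemma lext_r n m (a : 'X_{1..n}) (j : 'I_m) : lext m a (rshift n j) = 0%N.
Proof. by rewrite lextE (unsplitK (inr j)). Qed.

Lemma lextK n m : cancel (@lext n m) (@lpart n m).
Proof. by move=> a; apply/mnmP => i; rewrite mnmE lext_l. Qed.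

Lemma mdeg_parts n m (c : 'X_{1..n + m}) :
  mdeg c = (mdeg (lpart c) + mdeg (rpart c))%N.
Proof.
rewrite !mdegE big_split_ord /=.
by congr addn; apply: eq_bigr => i _; rewrite mnmE.
Qed.

Lemma mdeg_lext n m (a : 'X_{1..n}) : mdeg (lext m a) = mdeg a.
Proof.
rewrite mdeg_parts lextK [mdeg (rpart _)]mdegE big1 ?addn0 // => i _.
by rewrite mnmE lext_r.
Qed.

Lemma lext_lpart n m (c : 'X_{1..n + m}) :
  mdeg (rpart c) = 0%N -> lext m (lpart c) = c.
Proof.
move/eqP; rewrite mdeg_eq0 => /eqP c0; apply/mnmP => i.
rewrite -[i]splitK; case: (split i) => j /=; first by rewrite lext_l mnmE.
have := mnmE (fun i => c (rshift n i)) j; rewrite -/(rpart c) c0 mnm0E => <-.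
by rewrite lext_r.
Qed.

Lemma coeff_restrict n m (f : E (n + m)%N) c :
  coeff (restrict E n m f) c = coeff f (lext m c).
Proof.
pose sigma (i : 'I_(n + m)) := if split i is inl j then Some j else None.
have -> : restrict E n m = pullback (fun i =>
    if sigma i is Some j then coord E j else 0).
  by congr pullback; apply/funext => i; rewrite /sigma; case: (split i).
rewrite coeff_pullback_coord //.
have bc : (mdeg (lext m c) < (mdeg c).+1)%N by rewrite mdeg_lext.
rewrite (bigD1 (BMultinom bc)) /=; last first.
  apply/andP; split.
    by apply/forallP => i; rewrite /sigma lextE; case: (split i).
  apply/eqP; rewrite [LHS]multinomUE_id big_split_ord /=.
  rewrite [X in (_ + X)%MM]big1 ?addm0 => [|j _].
    by apply: eq_bigr => j _; rewrite /sigma (unsplitK (inl j)) lext_l.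
  by rewrite /sigma (unsplitK (inr j)).
rewrite big1 ?addr0 // => b /andP[/andP[/forallP b0 /eqP cE] /eqP []].
apply: val_inj => /=; apply/mnmP => i.
have b0' j : b (rshift n j) = 0%N.
  by have := b0 (rshift n j); rewrite /sigma (unsplitK (inr j)) => /eqP.
have cE' j : c j = b (lshift m j).
  have -> : c j = (\sum_(i < n + m) if sigma i is Some j then U_(j) *+ b i else 0)%MM j.
    by rewrite -cE.
  rewrite mnm_sumE big_split_ord /= [X in (_ + X)%N]big1 => [|l _]; last first.
    by rewrite /sigma (unsplitK (inr l)) mnm0E.
  rewrite addn0 (bigD1 j) //= /sigma (unsplitK (inl j)) mnm1nE eqxx.
  by rewrite big1 ?addn0 // => l lj; rewrite (unsplitK (inl l)) mnm1nE (negPf lj).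
rewrite -[i]splitK; case: (split i) => j /=; rewrite ?lext_l ?lext_r //.
Qed.

Lemma restrict_coord n m (i : 'I_(n + m)) : restrict E n m (coord E i) =
  if split i is inl j then coord E j else 0.
Proof.
rewrite pullback_coord // => j; case: (split j) => l; last exact: raddf0.
by rewrite at0_coord.
Qed.

Lemma at0_restrict n m (f : E (n + m)%N) : at0 (restrict E n m f) = at0 f.
Proof.
rewrite !at0E coeff_restrict; congr coeff.
apply/mnmP => i; rewrite lextE mnm0E; case: (split i) => // j.
by rewrite mnm0E.
Qed.

End Restriction.

Section Inclusion.
Context {K : fieldType} {E : smooth_data K} (hE : smooth_category E).
Context {k n : nat} (sigma : 'I_k -> 'I_n).

Lemma incl_coord i : incl E sigma (coord E i) = coord E (sigma i).
Proof. by rewrite pullback_coord // => j; rewrite at0_coord. Qed.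

Lemma at0_incl (f : E k) : at0 (incl E sigma f) = at0 f.
Proof. by rewrite at0_pullback // => i; rewrite at0_coord. Qed.

Hypothesis inj : injective sigma.

Lemma coeff_incl (f : E k) a : coeff (incl E sigma f) (mnm_push sigma a) = coeff f a.
Proof. by rewrite !coeff_hasse // sc_incl_hasse // at0_incl. Qed.

End Inclusion.

Section Hasse.
Context {K : fieldType} {E : smooth_data K} (hE : smooth_category E) {n : nat}.
Implicit Types (f g : E n) (a b c : 'X_{1..n}).

Lemma hasseD_disjoint a b f : (forall i, a i = 0%N \/ b i = 0%N) ->
  hasse a (hasse b f) = hasse (a + b)%MM f.
Proof. by move=> ab; rewrite sc_hasse_iter // mbinom_disjoint // mulr1n. Qed.

(** Every exponent involving the coordinate [i] is the sum of a pure power of it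
    and an exponent free of it, and the binomial coefficient of this sum is one;
    in positive characteristic this makes the derivatives along one axis
    control all mixed ones. *)
Lemma hasse_axis0 (i : 'I_n) f :
  (forall e, (0 < e)%N -> hasse (U_(i) *+ e)%MM f = 0) ->
  forall a, a i <> 0%N -> hasse a f = 0.
Proof.
move=> h a ai; have le : (U_(i) *+ a i <= a)%MM.
  by apply/mnm_lepP => j; rewrite mnm1nE; case: eqVneq => // ->.
rewrite -(submK le) -hasseD_disjoint.
  by rewrite h ?raddf0 // lt0n; apply/eqP.
move=> j; rewrite mnmBE mnm1nE; case: eqVneq => [->|_]; last by right.
by left; rewrite subnn.
Qed.

Lemma supd_coeff f a : coeff f a != 0 -> supd f a.
Proof.
by move=> fa; apply: contra_neq fa; rewrite coeff_hasse // => ->; rewrite raddf0.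
Qed.

Lemma supd_mul f g c : supd (f * g) c ->
  exists a b, [/\ c = (a + b)%MM, supd f a & supd g b].
Proof.
rewrite /supd /= sc_hasseM // => /eqP h; apply: contrapT => nex; apply: h.
apply: big1 => -[k1 k2] /= /eqP ck; case: (eqVneq (hasse k1 f) 0) => [->|f0].
  exact: mul0r.
case: (eqVneq (hasse k2 g) 0) => [->|g0]; first exact: mulr0.
by case: nex; exists k1, k2.
Qed.

Lemma supdD f g c : supd (f + g) c -> supd f c \/ supd g c.
Proof.
rewrite /supd /= raddfD /=; case: (eqVneq (hasse c f) 0) => [->|]; last by left.
by rewrite add0r; right.
Qed.

Lemma supdN f c : supd (- f) c -> supd f c.
Proof. by rewrite /supd /= raddfN oppr_eq0. Qed.

Lemma supdB f g c : supd (f - g) c -> supd f c \/ supd g c.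
Proof. by move/supdD => [|/supdN]; [left|right]. Qed.

Lemma supd0 c : ~ supd (0 : E n) c.
Proof. by rewrite /supd /= raddf0 eqxx. Qed.

Lemma supd_sum (I : eqType) (r : seq I) (P : pred I) (F : I -> E n) c :
  supd (\sum_(i <- r | P i) F i) c -> exists i, [/\ i \in r, P i & supd (F i) c].
Proof.
move=> h; apply: contrapT => nex; move: h; rewrite /supd /= raddf_sum /=.
rewrite big_seq_cond big1 ?eqxx // => i /andP[ir Pi]; apply/eqP; apply: contrapT => h.
by apply: nex; exists i; split => //; apply/negP.
Qed.

(** The unit comes from [E 0], where no direction is left to differentiate in. *)
Lemma supd1 c : supd (1 : E n) c -> c = 0%MM.
Proof.
have h i a : a i <> 0%N -> hasse a (1 : E n) = 0.
  apply: hasse_axis0 => e e0.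
  have inj0 : injective (widen_ord (leq0n n)) by case.
  apply: (sc_incl_image hE inj0 1).1 => //; first by exists 1; rewrite rmorph1.
  by case.
move=> /negP c1; apply/mnmP => i; rewrite mnm0E; apply: contrapT => ci.
by apply: c1; rewrite (h i).
Qed.

Lemma supd_coord i c : supd (coord E i) c -> c = 0%MM \/ c = U_(i)%MM.
Proof.
case: (eqVneq c 0%MM) => [->|c0]; first by left.
rewrite /supd /= sc_hasse_coord //; case: (eqVneq c U_(i)%MM) => [->|]; first by right.
by rewrite eqxx.
Qed.

Lemma supd_monom a c : supd (monom a : E n) c -> (c <= a)%MM.
Proof.
rewrite {2}(multinomUE_id a) /monom; elim: (index_enum _) c => [|i r IH] c.
  by rewrite !big_nil => /supd1 ->; exact: lepm_refl.
rewrite !big_cons => /supd_mul [c1 [c2 [-> h1 /IH h2]]]; apply: lepm_add h2.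
elim: (a i) c1 h1 => [|e IHe] c1; first by rewrite expr0 mulm0n => /supd1 ->; exact: lepm_refl.
rewrite exprS mulmS => /supd_mul [d1 [d2 [-> h1 /IHe h2]]]; apply: lepm_add h2.
case: (supd_coord h1) => ->; last exact: lepm_refl.
by apply/mnm_lepP => j; rewrite mnm0E.
Qed.

(** All derivatives of [hasse a (monom a)] vanish, since they are derivatives of
    [monom a] beyond [a]; it is thus a constant, known from its Taylor series. *)
Lemma hasse_monom_same a : hasse a (monom a : E n) = 1.
Proof.
have h b : b != 0%MM -> hasse b (hasse a (monom a : E n)) = 0.
  move=> b0; rewrite sc_hasse_iter //.
  case: (eqVneq (hasse (b + a)%MM (monom a : E n)) 0) => [->|]; first by rewrite mul0rn.
  move/supd_monom => /mnm_lepP le; case/eqP: b0; apply/mnmP => i.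
  have := le i; rewrite mnmDE mnm0E -[X in (_ <= X)%N]add0n leq_add2r leqn0.
  by move/eqP.
have inj0 : injective (widen_ord (leq0n n)) by case.
have [|g gE] := (sc_incl_image hE inj0 (hasse a (monom a))).2.
  by move=> i e _ e0; apply: h; rewrite -mdeg_eq0 mdegMn mdeg1 mul1n -lt0n.
have [x gx] := sc_base hE g.
rewrite gE gx linearZ /= rmorph1.
suff -> : x = 1 by rewrite scale1r.
have := coeff_hasse hE (monom a : E n) a.
rewrite coeff_monom // eqxx gE gx at0_incl // at0E coeffZ coeff1 eqxx mulr1.
by move<-.
Qed.

End Hasse.

(** * Weierstrass division *)

(** Nakayama's lemma in matrix form: multiply the relations by the inverse of
    [1 - mu]. The scalars act through [phi] because below a module over a ring of
    germs is to be generated over the subring of germs in the parameters. *)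
Lemma nakayama (A : comUnitRingType) (B : comNzRingType)
    (phi : {rmorphism A -> B}) (V : lmodType B) (P : V -> Prop)
    (P0 : P 0) (PD : forall u v, P u -> P v -> P (u + v))
    (PZ : forall a u, P u -> P (phi a *: u)) q (w : 'I_q -> V) (mu : 'M[A]_q) :
  1%:M - mu \in unitmx ->
  (forall i, P (w i - \sum_j phi (mu i j) *: w j)) -> forall i, P (w i).
Proof.
move=> mu_unit hw i; set N := invmx (1%:M - mu).
suff -> : w i = \sum_j phi (N i j) *: (w j - \sum_k phi (mu j k) *: w k).
  by elim/big_ind: _ => // j _; apply: PZ.
have NE k : (N *m (1%:M - mu)) i k = (i == k)%:R by rewrite mulVmx // mxE.
transitivity (\sum_k phi ((N *m (1%:M - mu)) i k) *: w k).
  rewrite (bigD1 i) //= NE eqxx rmorph1 scale1r big1 ?addr0 // => k ki.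
  by rewrite NE eq_sym (negPf ki) rmorph0 scale0r.
under eq_bigr => k _ do rewrite mxE rmorph_sum scaler_suml.
rewrite exchange_big /=; apply: eq_bigr => j _.
rewrite scalerBr scaler_sumr.
under eq_bigr => k _.
  rewrite !mxE mulrBr rmorphB scalerBl.
  rewrite [X in _ - X](_ : _ = phi (N i j) *: (phi (mu j k) *: w k)); last first.
    by rewrite scalerA rmorphM.
  over.
rewrite sumrB (bigD1 j) //= eqxx mulr1 big1 ?addr0 // => k kj.
by rewrite eq_sym (negPf kj) mulr0 rmorph0 scale0r.
Qed.

Section Weierstrass.
Context {K : fieldType} {E : smooth_data K} (hE : smooth_category E).

Lemma unitmx_sub1 n q (mu : 'M[E n]_q) : (forall i j, at0 (mu i j) = 0) ->
  1%:M - mu \in unitmx.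
Proof.
move=> mu0; rewrite unitmxE; apply: at0_unit => //.
rewrite -det_map_mx map_mxB map_mx1 [map_mx _ mu](_ : _ = 0) ?subr0 ?det1 ?oner_neq0 //.
by apply/matrixP => i j; rewrite !mxE; exact: mu0.
Qed.

Lemma mnm_pushU k n (sigma : 'I_k -> 'I_n) i e :
  mnm_push sigma (U_(i) *+ e)%MM = (U_(sigma i) *+ e)%MM.
Proof.
rewrite /mnm_push (bigD1 i) //= mnm1nE eqxx big1 ?addm0 // => j ji.
by rewrite mnm1nE eq_sym (negPf ji) mulm0n.
Qed.

(** The pure derivatives in the missing directions vanish on the image of an
    inclusion, and [hasse_axis0] extends this to the mixed ones. *)
Lemma supd_incl k n (sigma : 'I_k -> 'I_n) (f : E k) (c : 'X_{1..n}) i : injective sigma ->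
  (forall j, sigma j != i) -> supd (incl E sigma f) c -> c i = 0%N.
Proof.
move=> inj hi; apply: contraPP => ci; rewrite /supd /=; apply/negP; rewrite negbK.
apply/eqP; apply: (hasse_axis0 hE _ ci) => e e0.
by apply: (sc_incl_image hE inj _).1 => //; exists f.
Qed.

Lemma coeff_incl_out k n (sigma : 'I_k -> 'I_n) (f : E k) (c : 'X_{1..n}) i : injective sigma ->
  (forall j, sigma j != i) -> c i != 0%N -> coeff (incl E sigma f) c = 0.
Proof.
move=> inj hi ci; apply: contraTeq ci => /(supd_coeff hE) /(supd_incl inj hi) ->.
by rewrite eqxx.
Qed.

Lemma pullback_comp n m l (u : 'I_m -> E n) (w : 'I_l -> E m) g :
  (forall i, at0 (u i) = 0) -> (forall i, at0 (w i) = 0) ->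
  pullback u (pullback w g) = pullback (fun i => pullback u (w i)) g.
Proof.
move=> u0 w0; apply: (sc_pullback_comp hE) => i; rewrite maxidE //.
  by rewrite u0.
by rewrite w0.
Qed.

(** The preparation of [f] by the generic polynomial [t ^ d + y_1 t ^ (d-1) + ...]:
    write [f = h P + sum_i r_i (x, y) t ^ i]. If [f (t, 0)] has order [d], the
    coefficients of the powers of [t] give [r_i (0) = 0] and [h (0) <> 0], and
    those of [y_j t ^ i] show that the Jacobian matrix of [r] in [y] is triangular
    up to reversal of the indices, with diagonal [- h (0)]. *)
Section Preparation.
Variables (l d : nat) (f : E l.+1) (h : E (l.+1 + d)%N) (r : 'I_d -> E (l + d)%N).
Let t : 'I_(l.+1 + d) := lshift d (ord0 : 'I_l.+1).
Let y (j : 'I_d) : 'I_(l.+1 + d) := rshift l.+1 j.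
Let lft : 'I_(l + d) -> 'I_(l.+1 + d) := lift (ord0 : 'I_(l + d).+1).
Hypothesis hdiv : incl E (lshift d) f = h * generic_poly E l d +
  \sum_(i < d) incl E lft (r i) * coord E t ^+ i.
Hypothesis f_low : forall k, (k < d)%N -> coeff f (U_(ord0) *+ k)%MM = 0.
Hypothesis f_top : coeff f (U_(ord0) *+ d)%MM != 0.

Let ty j : t != y j.
Proof. by rewrite -val_eqE /= . Qed.
Let lft_t i : lft i != t.
Proof. by rewrite -val_eqE. Qed.
Let lft_inj : injective lft.
Proof. exact: lift_inj. Qed.
Let lftr j : lft (rshift l j) = y j.
Proof. exact/val_inj. Qed.

Let poly_monom : generic_poly E l d = monom (U_(t) *+ d)%MM +
  \sum_(j < d) monom (U_(y j) + U_(t) *+ (d - j.+1))%MM.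
Proof.
rewrite /generic_poly monomUn //; congr (_ + _); apply: eq_bigr => j _.
by rewrite monomD monomUn // monomU.
Qed.

Let mnm1n_le (n : nat) (i : 'I_n) k (c : 'X_{1..n}) :
  (U_(i) *+ k <= c)%MM = (k <= c i)%N.
Proof.
apply/mnm_lepP/idP => [/(_ i)|kc j]; first by rewrite mnm1nE eqxx.
by rewrite mnm1nE; case: eqVneq => // <-.
Qed.

Let coeff_rest i (c : 'X_{1..l.+1 + d}) : coeff (incl E lft (r i) * coord E t ^+ i) c =
  if c t == i then coeff (incl E lft (r i)) (c - U_(t) *+ i)%MM else 0.
Proof.
rewrite -monomUn // coeff_mul_monom // mnm1n_le.
case: (ltngtP (c t) i) => // lt.
apply: (@coeff_incl_out _ _ _ _ _ t) => //.
by rewrite mnmBE mnm1nE eqxx -lt0n subn_gt0.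
Qed.

Let coeff_f k : coeff (incl E (lshift d) f) (U_(t) *+ k)%MM =
  coeff f (U_(ord0) *+ k)%MM.
Proof. by rewrite -mnm_pushU coeff_incl //; apply: lshift_inj. Qed.

Let coeff_main k : coeff (h * generic_poly E l d) (U_(t) *+ k)%MM =
  if (d <= k)%N then coeff h (U_(t) *+ k - U_(t) *+ d)%MM else 0.
Proof.
rewrite poly_monom mulrDr coeffD coeff_mul_monom // mnm1n_le mnm1nE eqxx.
rewrite mulr_sumr coeff_sum [X in _ + X]big1 ?addr0 // => j _.
rewrite coeff_mul_monom //; case: ifP => // /mnm_lepP /(_ (y j)).
by rewrite mnmDE !mnm1nE mnm1E eqxx (negPf (ty j)).
Qed.

Let coeff_rests (c : 'X_{1..l.+1 + d}) (lt : (c t < d)%N) :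
  coeff (\sum_(i < d) incl E lft (r i) * coord E t ^+ i) c =
  coeff (incl E lft (r (Ordinal lt))) (c - U_(t) *+ c t)%MM.
Proof.
rewrite coeff_sum (bigD1 (Ordinal lt)) //= coeff_rest eqxx big1 ?addr0 // => i.
by rewrite -val_eqE /= eq_sym coeff_rest => /negPf ->.
Qed.

Lemma prep_rest0 i : at0 (r i) = 0.
Proof.
have := congr1 (fun F => coeff F (U_(t) *+ i)%MM) hdiv.
have tt : (U_(t) *+ i)%MM t = i by rewrite mnm1nE eqxx.
rewrite /= coeff_f f_low // coeffD coeff_main leqNgt ltn_ord /= add0r.
rewrite coeff_rests ?tt // => lt.
rewrite [Ordinal lt](_ : _ = i); last exact/val_inj.
have -> : (U_(t) *+ i - U_(t) *+ i)%MM = 0%MM :> 'X_{1..l.+1 + d}.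
  by apply/mnmP => j; rewrite mnmBE subnn mnm0E.
by rewrite -[coeff _ 0%MM]/(at0 _) at0_incl // => <-.
Qed.

Lemma prep_quot0 : at0 h != 0.
Proof.
have := congr1 (fun F => coeff F (U_(t) *+ d)%MM) hdiv.
rewrite /= coeff_f coeffD coeff_main leqnn coeff_sum big1 ?addr0 => [|i _].
  have -> : (U_(t) *+ d - U_(t) *+ d)%MM = 0%MM :> 'X_{1..l.+1 + d}.
    by apply/mnmP => j; rewrite mnmBE subnn mnm0E.
  by rewrite at0E => <-.
by rewrite coeff_rest mnm1nE eqxx gtn_eqF.
Qed.

Lemma prep_rest1 (i j : 'I_d) : coeff (r i) U_(rshift l j)%MM =
  - (if (d - j.+1 <= i)%N then coeff h (U_(t) *+ (i - (d - j.+1)))%MM else 0).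
Proof.
pose c := (U_(y j) + U_(t) *+ i)%MM : 'X_{1..l.+1 + d}.
have ct : c t = i.
  by rewrite mnmDE mnm1nE mnm1E eqxx eq_sym (negPf (ty j)).
have cy : c (y j) = 1%N.
  by rewrite mnmDE mnm1nE mnm1E eqxx (negPf (ty j)).
have := congr1 (fun F => coeff F c) hdiv.
rewrite /= (@coeff_incl_out _ _ _ _ _ (y j)) ?cy //; first last.
- by move=> j'; rewrite eq_lrshift.
- exact: lshift_inj.
rewrite coeffD coeff_rests ?ct // => lt.
rewrite [Ordinal lt](_ : _ = i); last exact/val_inj.
have -> : (c - U_(t) *+ i)%MM = (U_(y j) *+ 1)%MM by rewrite /c addmK mulm1n.
rewrite -lftr -mnm_pushU coeff_incl // mulm1n => /esym/eqP.
rewrite addrC addr_eq0 => /eqP ->; congr (- _).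
rewrite poly_monom mulrDr coeffD coeff_mul_monom // mnm1n_le ct leqNgt ltn_ord /=.
rewrite add0r mulr_sumr coeff_sum (bigD1 j) //= big1 ?addr0 => [|j' j'j]; last first.
  rewrite coeff_mul_monom //; case: ifP => // /mnm_lepP /(_ (y j')).
  rewrite !mnmDE !mnm1nE !mnm1E eqxx (negPf (ty j')).
  by rewrite (inj_eq (@rshift_inj _ _)) eq_sym (negPf j'j).
rewrite coeff_mul_monom //.
have -> : (U_(y j) + U_(t) *+ (d - j.+1) <= c)%MM = (d - j.+1 <= i)%N.
  apply/mnm_lepP/idP => [/(_ t)|le i'].
    by rewrite ct mnmDE mnm1nE mnm1E eqxx eq_sym (negPf (ty j)).
  by rewrite !mnmDE leq_add2l !mnm1nE; case: eqP.
case: ifP => // le; congr coeff; apply/mnmP => i'.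
by rewrite mnmBE !mnmDE subnDl !mnm1nE; case: eqP.
Qed.

(* The remainders are listed in reverse order so that the Jacobian block of
   [prep_jacobian] is triangular and not antitriangular. *)
Let u (i : 'I_(l + d)) : E (l + d)%N :=
  match split i with inl j => coord E (lshift d j) | inr j => r (rev_ord j) end.

Let u_l j : u (lshift d j) = coord E (lshift d j).
Proof. by rewrite /u (unsplitK (inl j)). Qed.
Let u_r j : u (rshift l j) = r (rev_ord j).
Proof. by rewrite /u (unsplitK (inr j)). Qed.
Let u0 i : at0 (u i) = 0.
Proof. by rewrite /u; case: (split i) => j; rewrite (at0_coord, prep_rest0). Qed.

(** The first [l] components of [u] are the coordinates [x] themselves, so the
    Jacobian matrix is block triangular. *)
Lemma prep_jacobian :
  \det (\matrix_(i < l + d, j < l + d) at0 (hasse U_(j)%MM (u i))) != 0.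
Proof.
set M := \matrix_(i, j) _; rewrite -(submxK M).
have -> : ursubmx M = 0.
  apply/matrixP => i j; rewrite !mxE u_l -coeff_hasse // -monomU //.
  by rewrite coeff_monom // eq_mnm1 eq_sym eq_lrshift.
have -> : ulsubmx M = 1%:M.
  apply/matrixP => i j; rewrite !mxE u_l -coeff_hasse // -monomU //.
  by rewrite coeff_monom // eq_mnm1 (inj_eq (@lshift_inj _ _)) eq_sym.
rewrite det_lblock det1 mul1r -det_tr det_trig; last first.
  apply/is_trig_mxP => i j ij; rewrite !mxE u_r -coeff_hasse // prep_rest1.
  case: ifP; rewrite ?oppr0 //= leqNgt => /negP []; apply: ltn_sub2l => //.
  exact: leq_ltn_trans ij (ltn_ord j).
apply/prodf_neq0 => i _; rewrite !mxE u_r -coeff_hasse // prep_rest1 /= leqnn.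
by rewrite subnn mulm0n oppr_eq0 prep_quot0.
Qed.

(** Substituting for the coefficients [y] of the generic polynomial a solution of
    [r_i (x, y) = 0], which exists by the inverse function theorem, turns the
    division of [f] into a factorization and the division of [g] into a division
    by [f]. *)
Lemma prep_division g : exists q (s : 'I_d -> E l),
  g = q * f + \sum_(i < d) incl E (lift ord0) (s i) * coord E ord0 ^+ i.
Proof.
have um i : u i \in maxid E _ by rewrite maxidE // u0.
have [w wm [uw _]] := sc_inverse hE um prep_jacobian.
have w0 i : at0 (w i) = 0 by apply/eqP; rewrite -maxidE.
have wu i : pullback w (u i) = coord E i by rewrite -[RHS]uw pullback_coord.
pose rho : {rmorphism E (l + d)%N -> E l} := restrict E l d \o pullback w.
have rho0 x : at0 (rho x) = at0 x by rewrite /= at0_restrict // at0_pullback.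
pose s (i : 'I_(l.+1 + d)) : E l.+1 := match split i with
  | inl j => coord E j
  | inr j => incl E (lift ord0) (rho (coord E (rshift l j))) end.
have s0 i : at0 (s i) = 0.
  by rewrite /s; case: (split i) => j; rewrite ?at0_incl ?rho0 ?at0_coord.
have s_l j : s (lshift d j) = coord E j by rewrite /s (unsplitK (inl j)).
have s_r j : s (rshift l.+1 j) = incl E (lift ord0) (rho (coord E (rshift l j))).
  by rewrite /s (unsplitK (inr j)).
have s_incl x : pullback s (incl E (lshift d) x) = x.
  rewrite pullback_comp // => [|i]; last exact: at0_coord.
  rewrite -[RHS](sc_pullback_id hE); congr (pullback _ x).
  by apply/funext => i; rewrite pullback_coord // s_l.
have rhoE x : rho x = pullback (fun i => restrict E l d (w i)) x.
  rewrite /= pullback_comp // => i; case: (split i) => j; last exact: raddf0.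
  exact: at0_coord.
have s_lft x : pullback s (incl E lft x) = incl E (lift ord0) (rho x).
  rewrite pullback_comp // => [|i]; last exact: at0_coord.
  rewrite rhoE /incl pullback_comp; first last.
  - by move=> i; rewrite at0_restrict.
  - by move=> i; exact: at0_coord.
  congr (pullback _ x); apply/funext => i; rewrite pullback_coord //.
  rewrite -[X in _ = pullback _ (restrict _ _ _ X)](pullback_coord hE i w0).
  rewrite -[i]splitK; case: (split i) => j /=; last by rewrite lftr s_r.
  rewrite [lft _](_ : _ = lshift d (lift ord0 j)); last exact/val_inj.
  rewrite s_l -u_l wu restrict_coord // (unsplitK (inl j)).
  by rewrite -/(incl E (lift ord0)) incl_coord.
have s_t : pullback s (coord E t) = coord E ord0 by rewrite pullback_coord // s_l.
have rho_r i : rho (r i) = 0.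
  rewrite /= -[i]rev_ordK -u_r wu restrict_coord //.
  by rewrite (unsplitK (inr (rev_ord i))).
have := congr1 (pullback s) hdiv; rewrite s_incl rmorphD rmorphM /=.
rewrite raddf_sum big1 ?addr0 /= => [fE|i _]; last first.
  by rewrite rmorphM /= s_lft rho_r raddf0 mul0r.
have [h' [r' gE]] := sc_division hE d g.
have := congr1 (pullback s) gE; rewrite s_incl rmorphD rmorphM /= raddf_sum /=.
rewrite -/lft -/t; under eq_bigr => i _.
  rewrite rmorphM rmorphXn /= s_lft s_t; over.
move=> ->; exists (pullback s h' * (pullback s h)^-1), (fun i => rho (r' i)).
rewrite fE mulrA divrK // at0_unit // at0_pullback //; exact: prep_quot0.
Qed.

End Preparation.

(** The quotient of [g] by [f] need not be unique, since flat germs may exist. *)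
Lemma weierstrass_division l d (f g : E l.+1) :
  (forall k, (k < d)%N -> coeff f (U_(ord0) *+ k)%MM = 0) ->
  coeff f (U_(ord0) *+ d)%MM != 0 ->
  exists q (s : 'I_d -> E l),
    g = q * f + \sum_(i < d) incl E (lift ord0) (s i) * coord E ord0 ^+ i.
Proof.
move=> f_low f_top; have [h [r hdiv]] := sc_division hE d f.
exact: (prep_division hdiv).
Qed.

End Weierstrass.

(** * Weierstrass division by a matrix *)

Section OneVariable.
Context {K : fieldType} {E : smooth_data K} (hE : smooth_category E).

Lemma mnm1_sum_ord1 (c : 'X_{1..1}) : c = (U_(ord0) *+ c ord0)%MM.
Proof. by apply/mnmP => i; rewrite mnm1nE !ord1 eqxx. Qed.

Lemma restrict0_at0 n (f : E n) : restrict E 0 n f = (at0 f)%:A.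
Proof.
have [c fc] := sc_base hE (restrict E 0 n f).
by rewrite -[X in X%:A](at0_restrict hE (n := 0)) fc at0E coeffZ coeff1 eqxx mulr1.
Qed.

(** As [E 0 = K], the kernel of the restriction to a point is the maximal ideal. *)
Lemma at0_eq0_div (f : E 1) : at0 f = 0 -> exists a, f = a * coord E ord0.
Proof.
move=> f0; have [|a fE] := (sc_restrict_ker hE (k := 0) (l := 1) f).1.
  by rewrite restrict0_at0 f0 scale0r.
by exists (a ord0); rewrite fE big_ord1; congr (_ * coord E _); apply/val_inj.
Qed.

Lemma expand_one_variable N (f : E 1) : exists q,
  f = \sum_(k < N) coeff f (U_(ord0) *+ k)%MM *: coord E ord0 ^+ k
      + q * coord E ord0 ^+ N.
Proof.
elim: N f => [|N IH] f; first by exists f; rewrite big_ord0 add0r mulr1.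
have [|a fa] := @at0_eq0_div (f - (at0 f)%:A).
  by rewrite !at0E coeffB coeffZ coeff1 eqxx mulr1 subrr.
have {}fa : f = (at0 f)%:A + a * coord E ord0 by rewrite -fa addrC subrK.
have [q aE] := IH a; exists q.
rewrite {1}fa {1}aE mulrDl mulr_suml -mulrA -exprSr addrA; congr (_ + _).
rewrite big_ord_recl /= mulm0n expr0; congr (_ + _).
apply: eq_bigr => k _; rewrite -scalerAl -exprSr; congr (_ *: _).
rewrite [in RHS]fa coeffD coeffZ coeff1 -monomU coeff_mul_monom //= -[U_(_)%MM in RHS]mulm1n.
have -> : (U_(ord0) *+ bump 0 k == 0 :> 'X_{1..1})%MM = false.
  by apply/negbTE; rewrite -mdeg_eq0 mdegMn mdeg1.
rewrite mulr0 add0r.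
have -> : (U_(ord0) *+ bump 0 k = U_(ord0) *+ k + U_(ord0) *+ 1 :> 'X_{1..1})%MM.
  by rewrite mulm1n /bump /= add1n mulmSr.
by rewrite lem_addl addmK.
Qed.

Lemma coeff_restrict1 l (f : E l.+1) k :
  coeff (restrict E 1 l f) (U_(ord0) *+ k)%MM = coeff f (U_(ord0) *+ k)%MM.
Proof.
rewrite coeff_restrict //; congr coeff; apply/mnmP => i.
rewrite -[i](@splitK 1 l); case: (@split 1 l i) => j /=.
  by rewrite lext_l !mnm1nE ord1 -!val_eqE.
by rewrite lext_r mnm1nE -val_eqE.
Qed.

Lemma restrict1_eq0 l (f : E l.+1) : restrict E 1 l f = 0 ->
  exists a : 'I_l -> E l.+1, f = \sum_(i < l) incl E (lift ord0) (coord E i) * a i.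
Proof.
move=> /(sc_restrict_ker hE (k := 1) (l := l)) [a fE]; exists a.
rewrite fE; apply: eq_bigr => i _; rewrite mulrC incl_coord //.
by congr (coord E _ * _); apply/val_inj.
Qed.

End OneVariable.

Section MatrixWeierstrass.
Context {K : fieldType} {E : smooth_data K} (hE : smooth_category E).
Context {disp : Order.disp_t} {O : orderType disp}.
Context {l p : nat} {F : 'M[E l.+1]_p} {c : 'I_p -> nat} {w : 'I_p -> nat -> O}.

Hypothesis wS : forall y k y' k', (w y k < w y' k')%O ->
  (w y k.+1 < w y' k'.+1)%O.
Hypothesis w_unbounded : forall y k, exists N, forall y' k', (N <= k')%N ->
  (w y k < w y' k')%O.
Hypothesis F_lead : forall a, coeff (F a a) (U_(ord0) *+ c a)%MM != 0.
Hypothesis F_tail : forall a y k, coeff (F a y) (U_(ord0) *+ k)%MM != 0 ->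
  (y, k) = (a, c a) \/ (w a (c a) < w y k)%O.

Let t n : E n.+1 := coord E ord0.
Let F0 : 'M[E 1]_p := map_mx (restrict E 1 l) F.
Let tv n (y : 'I_p) k : 'rV[E n.+1]_p := t n ^+ k *: delta_mx 0 y.

Let wD e y k y' k' : (w y k < w y' k')%O -> (w y (k + e) < w y' (k' + e))%O.
Proof. by move=> lt; elim: e => [|e IH]; rewrite ?addn0 // !addnS wS. Qed.

Let F0_lead a : coeff (F0 a a) (U_(ord0) *+ c a)%MM != 0.
Proof. by rewrite mxE coeff_restrict1. Qed.
Let F0_tail a y k : coeff (F0 a y) (U_(ord0) *+ k)%MM != 0 ->
  (y, k) = (a, c a) \/ (w a (c a) < w y k)%O.
Proof. by rewrite mxE coeff_restrict1 //; apply: F_tail. Qed.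

(** Leading-term reduction: modulo the rows of [F0], every monomial vector is a
    combination of monomial vectors of larger weight, and only finitely many
    weights occur below [t ^ N]. *)
Let reduction (N : nat) (U : O -> Prop) (Q : 'rV[E 1]_p -> Prop) :
  (forall o o', (o < o')%O -> U o -> U o') ->
  (forall u v, Q u -> Q v -> Q (u + v)) ->
  (forall (x : K) u, Q u -> Q (x%:A *: u)) ->
  (forall h, Q (h *m F0)) -> (forall q, Q (t 0 ^+ N *: q)) ->
  (forall y k, U (w y k) -> (k < c y)%N -> Q (tv 0 y k)) ->
  forall y k, U (w y k) -> Q (tv 0 y k).
Proof.
move=> Uup QD QZ QF QN Qc.
have Q0 : Q 0 by rewrite -(mul0mx _ F0); apply: QF.
have QN' y k : (N <= k)%N -> Q (tv 0 y k).
  by move=> Nk; rewrite /tv -(subnK Nk) addnC exprD -scalerA; apply: QN.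
pose S y k := [set x : 'I_p * 'I_N | (w y k < w x.1 x.2)%O]%SET.
suff main m y k : (#|S y k| < m)%N -> U (w y k) -> Q (tv 0 y k).
  by move=> y k; apply: main (ltnSn _).
elim: m y k => [//|m IH] y k Sm Uyk.
have [/QN'//|kN] := leqP N k; have [cy|/(Qc _ _ Uyk)//] := leqP (c y) k.
pose e := (k - c y)%N.
have step y' k' : (w y (c y) < w y' k')%O -> Q (tv 0 y' (k' + e)%N).
  move=> /(wD e); rewrite subnKC // => lt.
  have [/QN'//|k'N] := leqP N (k' + e).
  apply: IH (Uup _ _ lt Uyk); rewrite -ltnS; apply: leq_trans Sm.
  rewrite ltnS; apply: proper_card; apply/properP; split.
    by apply/fintype.subsetP => x; rewrite !inE; apply: lt_trans.
  by exists (y', Ordinal k'N); rewrite !inE /= ?lt ?ltxx.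
have cN := leq_ltn_trans cy kN.
have /choice[q qE] (y' : 'I_p) : exists q, F0 y y' =
    \sum_(k < N) coeff (F0 y y') (U_(ord0) *+ k)%MM *: t 0 ^+ k + q * t 0 ^+ N.
  exact: expand_one_variable.
pose lam := coeff (F0 y y) (U_(ord0) *+ c y)%MM.
have term y' (k' : nat) : (coeff (F0 y y') (U_(ord0) *+ k')%MM)%:A *: tv 0 y' (k' + e)%N =
    t 0 ^+ e *: ((coeff (F0 y y') (U_(ord0) *+ k')%MM *: t 0 ^+ k') *: delta_mx 0 y').
  by rewrite !scalerA -scalerAl mul1r exprD [t 0 ^+ k' * _]mulrC scalerAr.
pose rest := \sum_(x : 'I_p * 'I_N | x != (y, Ordinal cN))
    (coeff (F0 y x.1) (U_(ord0) *+ x.2)%MM)%:A *: tv 0 x.1 (x.2 + e)%N +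
  t 0 ^+ N *: \sum_y' (t 0 ^+ e * q y') *: delta_mx 0 y'.
have row_expand : t 0 ^+ e *: (delta_mx 0 y *m F0) = lam%:A *: tv 0 y k + rest.
  rewrite -rowE [row y F0]row_sum_delta.
  under eq_bigr => y' _ do rewrite mxE qE scalerDl scaler_suml.
  rewrite big_split /= scalerDr addrA; congr (_ + _); last first.
    rewrite !scaler_sumr; apply: eq_bigr => y' _.
    by rewrite !scalerA; congr (_ *: _); rewrite mulrA mulrC.
  rewrite pair_bigA (bigD1 (y, Ordinal cN)) //= scalerDr; congr (_ + _).
    by rewrite -term subnKC.
  by rewrite scaler_sumr; apply: eq_bigr => x _; rewrite term.
have <- : lam^-1%:A *: (t 0 ^+ e *: (delta_mx 0 y *m F0) - rest) = tv 0 y k.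
  rewrite row_expand addrK [LHS]scalerA [X in X *: _](_ : _ = 1) ?scale1r //.
  by rewrite -scalerAl mul1r scalerA mulVf ?F0_lead // scale1r.
have QN1 u : Q u -> Q (- u) by move=> /(QZ (-1)); rewrite scaleN1r scaleN1r.
apply: (QZ); apply: (QD); first by rewrite scalemxAl; apply: (QF).
apply: QN1; apply: (QD); last exact: QN.
elim/big_ind: _ => // -[y' k'] /= ne.
have [->|nz] := eqVneq (coeff (F0 y y') (U_(ord0) *+ k')%MM) 0.
  by rewrite scale0r scale0r.
apply: QZ; apply: step; case: (F0_tail nz) => // -[yE kE].
by case/eqP: ne; congr pair => //; apply: val_inj.
Qed.

(** [N] exceeds the weights of all the monomial vectors [t ^ k e_y] with
    [k < c y]. *)
Let below_weights : exists N, forall y k y' k', (N <= k)%N -> (k' < c y')%N ->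
  (w y' k' < w y k)%O.
Proof.
have /choice[g gP] (x : 'I_p * nat) : exists N, forall y k, (N <= k)%N ->
    (w x.1 x.2 < w y k)%O by apply: w_unbounded.
exists (\max_(y' < p) \max_(k' < c y') g (y', val k'))%N => y k y' k' Nk lt.
apply: (gP (y', k')); apply: leq_trans Nk.
rewrite (bigD1 y') //= leq_max; apply/orP; left.
by rewrite (bigD1 (Ordinal lt)) //= leq_max leqnn.
Qed.

(** Beyond the weights of all possible remainders the reduction leaves none, so
    [t ^ N e_y] is in the row space up to [t ^ (N + 1)]; Nakayama's lemma over
    [E 1] removes this error. *)
Let power_in_rows : exists N, forall q : 'rV[E 1]_p, exists h, t 0 ^+ N *: q = h *m F0.
Proof.
have [N Nbig] := below_weights; exists N.
pose U o := forall y' k', (k' < c y')%N -> (w y' k' < o)%O.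
pose Q (G : 'rV[E 1]_p) := exists h q, G = h *m F0 + t 0 ^+ N.+1 *: q.
have QE y : Q (tv 0 y N).
  apply: (@reduction N.+1 U Q).
  - by move=> o o' oo' Uo y' k' /Uo lt; apply: lt_trans oo'.
  - move=> u v [h [q ->]] [h' [q' ->]]; exists (h + h'), (q + q').
    by rewrite mulmxDl scalerDr addrACA.
  - move=> x u [h [q ->]]; exists (x%:A *: h), (x%:A *: q).
    by rewrite scalerDr scalemxAl !scalerA [x%:A * _]mulrC.
  - by move=> h; exists h, 0; rewrite scaler0 addr0.
  - by move=> q; exists 0, q; rewrite mul0mx add0r.
  - by move=> y' k' Uyk /Uyk; rewrite ltxx.
  - by move=> y' k'; apply: Nbig.
have /choice[hq hqP] y : exists hq : 'rV[E 1]_p * 'rV[E 1]_p,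
    tv 0 y N = hq.1 *m F0 + t 0 ^+ N.+1 *: hq.2.
  by have [h [q ->]] := QE y; exists (h, q).
pose P (G : 'rV[E 1]_p) := exists h, G = h *m F0.
have PD u v : P u -> P v -> P (u + v).
  by move=> [h ->] [h' ->]; exists (h + h'); rewrite mulmxDl.
have PZ a u : P u -> P (a *: u) by move=> [h ->]; exists (a *: h); rewrite scalemxAl.
have P0 : P 0 by exists 0; rewrite mul0mx.
have PE y : P (tv 0 y N).
  apply: (@nakayama _ _ idfun _ P P0 PD PZ _ (fun y => tv 0 y N)
     (\matrix_(y, y') (t 0 * (hq y).2 0 y'))).
    by apply: unitmx_sub1 => // i j; rewrite mxE rmorphM /= at0_coord // mul0r.
  move=> y'; exists (hq y').1; rewrite [X in X - _]hqP -[LHS]addrA -[RHS]addr0; congr (_ + _).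
  rewrite [(hq y').2 in X in X - _]row_sum_delta scaler_sumr -sumrB big1 // => j _.
  apply/eqP; rewrite subr_eq0 /= mxE /tv !scalerA; apply/eqP; congr (_ *: _).
  by rewrite exprS mulrAC.
move=> q; rewrite [q]row_sum_delta scaler_sumr.
rewrite -[exists h, _]/(P _).
by elim/big_ind: _ => // y _; rewrite scalerA mulrC -scalerA; apply: PZ (PE y).
Qed.

Let remainder (n := l) (r : 'I_p -> nat -> E n) : 'rV[E n.+1]_p :=
  \row_y \sum_(k < c y) incl E (lift ord0) (r y k) * t n ^+ k.

(** Reduction modulo [t ^ N] suffices, multiples of [t ^ N] being in the row space
    of [F0]. This is where flat germs in [t] are absorbed. *)
Let span_at_origin (G : 'rV[E 1]_p) : exists h (v : 'I_p -> nat -> K),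
  G = h *m F0 + \row_y \sum_(k < c y) v y k *: t 0 ^+ k.
Proof.
pose Q G := exists h (v : 'I_p -> nat -> K),
  G = h *m F0 + \row_y \sum_(k < c y) v y k *: t 0 ^+ k.
have [N Nrow] := power_in_rows.
have QF h : Q (h *m F0).
  exists h, (fun _ _ => 0); rewrite -[LHS]addr0; congr (_ + _); apply/rowP => y.
  by rewrite !mxE big1 // => k _; rewrite scale0r.
have QD u v : Q u -> Q v -> Q (u + v).
  move=> [h [a ->]] [h' [a' ->]]; exists (h + h'), (fun y k => a y k + a' y k).
  rewrite mulmxDl addrACA; congr (_ + _); apply/rowP => y; rewrite !mxE -big_split.
  by apply: eq_bigr => k _; rewrite scalerDl.
have QZ (x : K) u : Q u -> Q (x%:A *: u).
  move=> [h [a ->]]; exists (x%:A *: h), (fun y k => x * a y k).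
  rewrite scalerDr scalemxAl; congr (_ + _); apply/rowP => y; rewrite !mxE mulr_sumr.
  by apply: eq_bigr => k _; rewrite -scalerAl mul1r scalerA.
have QN q : Q (t 0 ^+ N *: q) by have [h ->] := Nrow q.
have QE y k : Q (tv 0 y k).
  apply: (@reduction N (fun=> True) Q) => // {}y {}k _ kc.
  exists 0, (fun y' k' => ((y' == y) && (k' == k))%:R).
  rewrite mul0mx add0r; apply/rowP => y'; rewrite !mxE eqxx /= eq_sym.
  case: eqVneq => [yy'|_] /=; last first.
    by rewrite mulr0 big1 // => k' _; rewrite scale0r.
  case: y' / yy'; rewrite mulr1 (bigD1 (Ordinal kc)) //= eqxx scale1r big1 ?addr0 // => k'.
  by rewrite -val_eqE /= => /negPf ->; rewrite scale0r.
have Q0 : Q 0 by rewrite -(mul0mx _ F0); apply: QF.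
rewrite [G]row_sum_delta; elim/big_ind: _ => // y _.
have [q ->] := expand_one_variable hE N (G 0 y).
rewrite scalerDl; apply: (QD); last by rewrite mulrC -scalerA; apply: QN.
rewrite scaler_suml; elim/big_ind: _ => // k _.
rewrite [X in Q X](_ : _ = (coeff (G 0 y) (U_(ord0) *+ k)%MM)%:A *: tv 0 y k).
  by apply: QZ.
by rewrite [RHS]scalerA -scalerAl mul1r.
Qed.

(** A scalar matrix [t ^ N] is a multiple of [F0], so the determinant of [F0]
    divides a power of [t] and has a nonzero Taylor series. *)
Let det_order : exists d, (forall k, (k < d)%N -> coeff (\det F) (U_(ord0) *+ k)%MM = 0)
  /\ coeff (\det F) (U_(ord0) *+ d)%MM != 0.
Proof.
have [N Nrow] := power_in_rows.
have /choice[H HP] y : exists H, tv 0 y N = H *m F0 by apply: Nrow.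
have HF : (\matrix_y H y) *m F0 = (t 0 ^+ N)%:M.
  apply/row_matrixP => y; rewrite row_mul rowK -HP /tv rowE mul_mx_scalar //.
have det0 : \det F0 = restrict E 1 l (\det F) by rewrite det_map_mx.
have ex : exists d, coeff (\det F) (U_(ord0) *+ d)%MM != 0.
  apply: contrapT => nex; have F0_0 e : coeff (\det F0) e = 0.
    rewrite [e]mnm1_sum_ord1 det0 coeff_restrict1 //; apply/eqP/negPn/negP => h.
    by apply: nex; exists (e ord0).
  have := congr1 (fun M => coeff (\det M) (U_(ord0) *+ (N * p))%MM) HF.
  rewrite /= det_mulmx det_scalar -exprM -monomUn // coeff_monom // eqxx.
  rewrite coeffM big1 => [/esym/eqP|k _]; last by rewrite F0_0 mulr0.
  by rewrite oner_eq0.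
exists (ex_minn ex); case: ex_minnP => d dP dmin; split=> // k kd.
by apply: contraTeq kd => /dmin; rewrite -leqNgt.
Qed.

(** The module of vectors modulo the rows of [F] is finite over the ring [E l]
    of parameters, because the determinant of [F] kills it and can be divided by;
    by Nakayama's lemma it is then generated by any family generating it when the
    parameters vanish. *)
Lemma matrix_weierstrass_division (G : 'rV[E l.+1]_p) :
  exists h (r : 'I_p -> nat -> E l), G = h *m F +
    \row_y \sum_(k < c y) incl E (lift ord0) (r y k) * coord E ord0 ^+ k.
Proof.
pose iota : {rmorphism E l -> E l.+1} := incl E (lift ord0).
have [d [d_low d_top]] := det_order.
have finite (G' : 'rV[E l.+1]_p) : exists h (s : 'I_p -> 'I_d -> E l),
    G' = h *m F + \sum_y \sum_(k < d) iota (s y k) *: tv l y k.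
  have /choice[q qP] y : exists q : E l.+1 * ('I_d -> E l), G' 0 y =
      q.1 * \det F + \sum_(k < d) iota (q.2 k) * t l ^+ k.
    have [a [s ->]] := weierstrass_division hE (G' 0 y) d_low d_top.
    by exists (a, s).
  exists (\sum_y (q y).1 *: row y (\adj F)), (fun y => (q y).2).
  rewrite mulmx_suml -big_split /= [LHS]row_sum_delta; apply: eq_bigr => y _.
  rewrite qP scalerDl scaler_suml; congr (_ + _).
    rewrite -scalemxAl -row_mul mul_adj_mx -scalerA; congr (_ *: _).
    by rewrite rowE mul_mx_scalar.
  by apply: eq_bigr => k _; rewrite scalerA.
pose P (G' : 'rV[E l.+1]_p) := exists h r, G' = h *m F + remainder r.
have PF h : P (h *m F).
  exists h, (fun _ _ => 0); rewrite -[LHS]addr0; congr (_ + _); apply/rowP => y.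
  by rewrite !mxE big1 // => k _; rewrite raddf0 mul0r.
have PD u v : P u -> P v -> P (u + v).
  move=> [h [a ->]] [h' [a' ->]]; exists (h + h'), (fun y k => a y k + a' y k).
  rewrite mulmxDl addrACA; congr (_ + _); apply/rowP => y; rewrite !mxE -big_split.
  by apply: eq_bigr => k _; rewrite raddfD mulrDl.
have PZ a u : P u -> P (iota a *: u).
  move=> [h [r ->]]; exists (iota a *: h), (fun y k => a * r y k).
  rewrite scalerDr scalemxAl; congr (_ + _); apply/rowP => y; rewrite !mxE mulr_sumr.
  by apply: eq_bigr => k _; rewrite rmorphM mulrA.
have P0 : P 0 by rewrite -(mul0mx _ F); apply: PF.
have t_restrict : restrict E 1 l (t l) = t 0.
  rewrite /t -[ord0 in LHS](_ : lshift l (ord0 : 'I_1) = _); last exact/val_inj.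
  by rewrite restrict_coord // (unsplitK (inl ord0)).
have rho_const N (v : nat -> K) : restrict E 1 l
    (\sum_(k < N) iota (v k)%:A * t l ^+ k) = \sum_(k < N) v k *: t 0 ^+ k.
  pose rho : {lrmorphism E l.+1 -> E 1} := restrict E 1 l.
  rewrite -[LHS]/(rho _) rmorph_sum; apply: eq_bigr => k _.
  rewrite rmorphM rmorphXn /= t_restrict /iota linearZ rmorph1 /=.
  by rewrite -[restrict _ _ _ _]/(rho _) linearZ rmorph1 /= -scalerAl mul1r.
(* Modulo the parameters the generators [t ^ k e_y], [k < d], reduce to those with
   [k < c y]; the coefficients [mu] of the error vanish at the origin. *)
have modz (x : 'I_p * 'I_d) : exists mu : 'I_p * 'I_d -> E l,
    (forall x', at0 (mu x') = 0) /\
    P (tv l x.1 x.2 - \sum_x' iota (mu x') *: tv l x'.1 x'.2).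
  case: x => y k /=.
  have [h0 [v vE]] := span_at_origin (map_mx (restrict E 1 l) (tv l y k)).
  have [h hE0] : exists h : 'rV[E l.+1]_p, map_mx (restrict E 1 l) h = h0.
    have /choice[h hP] y' : exists h, restrict E 1 l h = h0 0 y'.
      exact: (sc_restrict_surj hE (k := 1)).
    by exists (\row_y h y); apply/rowP => y'; rewrite !mxE.
  pose R := remainder (fun y k => (v y k)%:A).
  have /choice[a aP] y' : exists a : 'I_l -> E l.+1,
      (tv l y k - h *m F - R) 0 y' = \sum_(i < l) iota (coord E i) * a i.
    apply: restrict1_eq0 => //.
    have -> (M : 'rV[E l.+1]_p) : restrict E 1 l (M 0 y') = map_mx (restrict E 1 l) M 0 y'.
      by rewrite mxE.
    rewrite !map_mxB map_mxM hE0 vE [X in X - _]addrAC subrr add0r /R /remainder !mxE.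
    by apply/eqP; rewrite subr_eq0 eq_sym; apply/eqP; apply: rho_const.
  have /choice[hs hsP] i : exists hs : 'rV[E l.+1]_p * ('I_p -> 'I_d -> E l),
      \row_y' a y' i = hs.1 *m F + \sum_y' \sum_(k' < d) iota (hs.2 y' k') *: tv l y' k'.
    by have [h' [s ->]] := finite (\row_y' a y' i); exists (h', s).
  exists (fun x => \sum_(i < l) coord E i * (hs i).2 x.1 x.2); split=> [x|].
    by rewrite rmorph_sum big1 // => i _; rewrite rmorphM /= at0_coord // mul0r.
  have -> : tv l y k = (h + \sum_(i < l) iota (coord E i) *: (hs i).1) *m F + R +
      \sum_x iota (\sum_(i < l) coord E i * (hs i).2 x.1 x.2) *: tv l x.1 x.2.
    rewrite -[LHS](subrK (h *m F)) -[X in X + _](subrK R) mulmxDl.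
    rewrite (_ : tv l y k - h *m F - R = (\sum_(i < l) iota (coord E i) *: (hs i).1) *m F
      + \sum_x iota (\sum_(i < l) coord E i * (hs i).2 x.1 x.2) *: tv l x.1 x.2).
      by rewrite [LHS]addrC !addrA [RHS]addrAC.
    transitivity (\sum_(i < l) iota (coord E i) *: \row_y' a y' i).
      by apply/rowP => y'; rewrite aP summxE; apply: eq_bigr => i _; rewrite !mxE.
    rewrite mulmx_suml; under [X in _ = _ + X]eq_bigr => x _ do rewrite rmorph_sum scaler_suml.
    rewrite exchange_big -big_split /=; apply: eq_bigr => i _.
    rewrite hsP scalerDr scalemxAl; congr (_ + _).
    rewrite pair_bigA scaler_sumr; apply: eq_bigr => x _.
    by rewrite scalerA rmorphM.
  by rewrite addrK; apply: PD; [apply: PF|exists 0, (fun y k => (v y k)%:A); rewrite mul0mx add0r].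
have [mu muP] := choice modz.
have Ptv y (k : 'I_d) : P (tv l y k).
  pose ev (j : 'I_#|{: 'I_p * 'I_d}|) : 'I_p * 'I_d := enum_val j.
  have := @nakayama _ _ iota _ P P0 PD PZ _ (fun j => tv l (ev j).1 (ev j).2)
     (\matrix_(j, j') mu (ev j) (ev j')).
  move=> /(_ _ _ (enum_rank (y, k))); rewrite /ev enum_rankK; apply.
    by apply: unitmx_sub1 => // i j; rewrite mxE (muP _).1.
  move=> i; have := (muP (ev i)).2.
  by rewrite big_enum_val; under [in X in _ -> X]eq_bigr => j _ do rewrite mxE.
have [h [s ->]] := finite G; suff : P (\sum_y \sum_(k < d) iota (s y k) *: tv l y k).
  by move=> [h' [r ->]]; exists (h + h'), r; rewrite mulmxDl addrA.
elim/big_ind: _ => // y _; elim/big_ind: _ => // k _; exact: PZ.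
Qed.

End MatrixWeierstrass.

(** * Monomial weights *)

Section Weights.
Context {disp : Order.disp_t} {O : orderType disp}.

(** A weight into a total order plays the role of a monomial order; distinct
    exponents may have equal weights, as with a grading that is not total. *)
Definition wf_weight (X : Type) (w : X -> O) : Prop :=
  forall S : set X, S !=set0 -> exists2 a, S a & forall b, S b -> (w a <= w b)%O.

Definition additive_weight n (w : 'X_{1..n} -> O) : Prop :=
  forall a b c, (w a < w b)%O -> (w (a + c)%MM < w (b + c)%MM)%O.

Lemma wf_weight_comp (X Y : Type) (w : X -> O) (f : Y -> X) :
  wf_weight w -> wf_weight (w \o f).
Proof.
move=> wf S [y Sy]; have [|_ [b Sb <-] bmin] := wf (f @` S).
  by exists (f y), y.
by exists b => // c Sc; apply: bmin; exists c.
Qed.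

End Weights.

Lemma wf_weight_lexi (disp : Order.disp_t) (O : orderType disp) (X : Type)
    (v : X -> nat) (w : X -> O) :
  wf_weight w -> wf_weight (fun x => (v x, w x) : (nat *l O)%type).
Proof.
move=> wf S [x Sx].
have ex : exists d, `[< exists2 x, S x & v x = d >] by exists (v x); apply/asboolP; exists x.
case: (ex_minnP ex) => d /asboolP[x0 Sx0 vx0] dmin.
have [|a [Sa va] amin] := wf [set a | S a /\ v a = d]; first by exists x0.
exists a => // b Sb; rewrite leEprodlexi /= va.
have db : (d <= v b)%N by apply: dmin; apply/asboolP; exists b.
rewrite leEnat db /=; apply/implyP => bd; apply: amin; split=> //.
by apply/eqP; rewrite eqn_leq bd.
Qed.

Lemma ltxi_natE (disp : Order.disp_t) (O : orderType disp) (i j : nat) (x y : O) :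
  (((i, x) : (nat *l O)%type) < ((j, y) : (nat *l O)%type))%O =
  (i < j)%N || (i == j) && (x < y)%O.
Proof. by rewrite ltxi_pair !leEnat; case: (ltngtP i j). Qed.

Section Grade.
Context {R : realType} {k n : nat} {T : 'M[R]_(k.+1, n)}.
Hypothesis hT : normalized_grading T.
Implicit Types a b c : 'X_{1..n}.

Lemma grade_tnth a i : tnth (grade T a) i = \sum_(j < n) T i j * (a j)%:R.
Proof. exact: tnth_mktuple. Qed.

Lemma grade_tnthD a b i :
  tnth (grade T (a + b)%MM) i = tnth (grade T a) i + tnth (grade T b) i.
Proof.
rewrite !grade_tnth -big_split; apply: eq_bigr => j _.
by rewrite mnmDE natrD mulrDr.
Qed.

Lemma grade_tnth0 a : tnth (grade T a) ord0 = (mdeg a)%:R.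
Proof.
rewrite grade_tnth mdegE natr_sum; apply: eq_bigr => j _.
by rewrite hT.2 mul1r.
Qed.

Lemma grade_lt_mdeg a b : (mdeg a < mdeg b)%N -> (grade T a < grade T b)%O.
Proof.
move=> ab; apply/ltxi_tuplePlt; exists ord0 => [i|]; first by rewrite ltn0.
by rewrite !grade_tnth0 Num.Theory.ltr_nat.
Qed.

Lemma grade_additive : additive_weight (grade T).
Proof.
move=> a b c /ltxi_tuplePlt [i eqi lti]; apply/ltxi_tuplePlt; exists i => [j /eqi e|].
  by rewrite !grade_tnthD e.
by rewrite !grade_tnthD Num.Theory.ltrD2r.
Qed.

(** There are finitely many exponents of a given total degree, and the total
    degree is the first component of the grade. *)
Lemma wf_grade : wf_weight (grade T).
Proof.
move=> S [x Sx].
have bx : (mdeg x < (mdeg x).+1)%N by [].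
pose P (b : 'X_{1..n < (mdeg x).+1}) := `[< S b >].
have Px : P (BMultinom bx) by apply/asboolP.
case: (Order.TotalTheory.arg_minP
  (fun b : 'X_{1..n < (mdeg x).+1} => grade T b) Px) => a /asboolP Sa amin.
exists a => // b Sb; case: (ltnP (mdeg b) (mdeg x).+1) => [bb|xb].
  by apply: (amin (BMultinom bb)); apply/asboolP.
apply: le_trans (amin _ Px) _; apply: ltW; exact: grade_lt_mdeg.
Qed.

End Grade.

(** * Weights of the terms of a division *)

Section DivisionWeights.
Context {K : fieldType} {E : smooth_data K} (hE : smooth_category E) {n : nat}.
Context {disp : Order.disp_t} {O : orderType disp} {w : 'X_{1..n} -> O}.
Context {I : finType} {alpha : I -> 'X_{1..n}} {f h : I -> E n} {g r : E n}.

Hypothesis w_wf : wf_weight w.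
Hypothesis w_add : additive_weight w.
Hypothesis gE : g = \sum_x h x * f x + r.
Hypothesis f_lead : forall x, coeff (f x) (alpha x) != 0.
Hypothesis f_tail : forall x b, coeff (f x) b != 0 -> b <> alpha x ->
  (w (alpha x) < w b)%O.
Hypothesis h_disjoint : forall x x' c c', coeff (h x) c != 0 ->
  coeff (h x') c' != 0 -> (alpha x + c = alpha x' + c')%MM -> x = x'.
Hypothesis r_disjoint : forall x c, coeff (h x) c != 0 ->
  coeff r (alpha x + c)%MM = 0.

(** Leading terms of distinct summands sit at distinct exponents and hence cannot
    cancel: a leading exponent of minimal weight outside the upper set [U] would
    occur in [g]. *)
Lemma division_weights (U : O -> Prop) :
  (forall o o', (o <= o')%O -> U o -> U o') ->
  (forall c, coeff g c != 0 -> U (w c)) ->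
  (forall c, coeff r c != 0 -> U (w c)) /\
  (forall x c, coeff (h x) c != 0 -> U (w (alpha x + c)%MM)).
Proof.
move=> Uup gU.
pose S := [set e | ~ U (w e) /\
  (coeff r e != 0 \/ exists x c, coeff (h x) c != 0 /\ e = (alpha x + c)%MM)].
suff S0 : ~ (S !=set0).
  split=> [c rc|x c hc]; apply: contrapT => nU; apply: S0.
    by exists c; split=> //; left.
  by exists (alpha x + c)%MM; split=> //; right; exists x, c.
move=> /w_wf [e [nUe eS] emin].
have only x a b : e = (a + b)%MM -> coeff (h x) a * coeff (f x) b != 0 ->
    b = alpha x.
  rewrite mulf_eq0 negb_or => eE /andP[ha fb]; apply: contrapT => ne.
  have lt : (w (alpha x + a)%MM < w e)%O.
    by rewrite eE [(a + b)%MM]addmC; apply: w_add; apply: f_tail.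
  have : (w e <= w (alpha x + a)%MM)%O.
    apply: emin; split; first by move/(Uup _ _ (ltW lt)).
    by right; exists x, a.
  by rewrite leNgt lt.
have coeff_ge : coeff g e = \sum_x coeff (h x * f x) e + coeff r e.
  by rewrite gE coeffD coeff_sum.
case: eS => [re|[x [c [hc eE]]]].
  apply: nUe; apply: gU; rewrite coeff_ge big1 ?add0r // => x _.
  rewrite coeffM big1 // => k /eqP ke; apply: contrapT => /eqP nz.
  have kx := only _ _ _ ke nz; move: nz; rewrite mulf_eq0 negb_or => /andP[hk _].
  by move: re; rewrite ke kx addmC r_disjoint // eqxx.
have re0 : coeff r e = 0 by rewrite eE r_disjoint.
apply: nUe; apply: gU; rewrite coeff_ge re0 addr0.
have ca : e = (c + alpha x)%MM by rewrite addmC.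
have bc : (mdeg c < (mdeg e).+1)%N by rewrite ltnS ca mdegD leq_addr.
have ba : (mdeg (alpha x) < (mdeg e).+1)%N by rewrite ltnS ca mdegD leq_addl.
rewrite (bigD1 x) //= [X in _ + X]big1 ?addr0 => [|x' x'x]; last first.
  rewrite coeffM big1 // => k /eqP ke; apply: contrapT => /eqP nz.
  have kx := only _ _ _ ke nz; move: nz; rewrite mulf_eq0 negb_or => /andP[hk _].
  case/eqP: x'x; apply: (h_disjoint hk hc).
  by rewrite -eE addmC -kx -ke.
rewrite coeffM (bigD1 (BMultinom bc, BMultinom ba)) /=; last by apply/eqP.
rewrite big1 ?addr0 ?mulf_neq0 // => -[k1 k2] /= /andP[/eqP ke ne].
apply: contrapT => /eqP nz; have kx := only _ _ _ ke nz.
case/eqP: ne; congr pair; apply: val_inj => //=.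
have : (k1 + k2 = c + alpha x)%MM := etrans (esym ke) ca.
by rewrite kx => /(congr1 (fun b => b - alpha x)%MM); rewrite !addmK.
Qed.

End DivisionWeights.

(** * Diagrams and their sectors *)

Section Diagrams.
Context {n : nat} {I : finType} (alpha : I -> 'X_{1..n}).
Implicit Types a b c : 'X_{1..n}.

Definition generated : set 'X_{1..n} := [set b | exists x, (alpha x <= b)%MM].

(** The translate by [- alpha x] of the part of the diagram attributed to the
    generator [x]: the exponents allowed in the quotient by [f x]. *)
Definition sector (x : I) : set 'X_{1..n} := [set c | forall x',
  revlex_lt (alpha x') (alpha x) -> ~~ (alpha x' <= alpha x + c)%MM].

Lemma revlexP a b :
  revlex_lt a b <-> exists2 i : 'I_n, forall j : 'I_n, (i < j)%N -> a j = b j & (a i < b i)%N.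
Proof.
split=> [/ltxi_tuplePlt [i eqi lti]|[i eqi lti]].
  exists (rev_ord i) => [j ij|]; last by move: lti; rewrite !tnth_mktuple.
  have := eqi (rev_ord j); rewrite !tnth_mktuple !rev_ordK; apply.
  have := ltn_ord i; have := ltn_ord j; move: ij => /=; lia.
apply/ltxi_tuplePlt; exists (rev_ord i) => [j ij|]; rewrite !tnth_mktuple ?rev_ordK //.
by apply: eqi; have := ltn_ord i; have := ltn_ord j; move: ij => /=; lia.
Qed.

Lemma revlex_total a b : a <> b -> revlex_lt a b \/ revlex_lt b a.
Proof.
move=> ab; have [|] : (mrev a < mrev b)%O \/ (mrev b < mrev a)%O; last 2 first.
- by left.
- by right.
case: (ltgtP (mrev a) (mrev b)) => [||e]; [by left|by right|case: ab].
apply/mnmP => i; have := congr1 (fun t => tnth t (rev_ord i)) e.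
by rewrite !tnth_mktuple rev_ordK.
Qed.

Lemma generated_le a b : (a <= b)%MM -> generated a -> generated b.
Proof. by move=> ab [x xa]; exists x; apply: lepm_trans ab. Qed.

(** Attribute [b] to the smallest generator below it in the reverse lexicographic order. *)
Lemma generatedP b : generated b ->
  exists2 x, (alpha x <= b)%MM & sector x (b - alpha x)%MM.
Proof.
move=> [x0 x0b].
case: (Order.TotalTheory.arg_minP (P := fun x => (alpha x <= b)%MM) (fun x => mrev (alpha x)) x0b).
move=> x xb xmin; exists x => // x' lt; apply/negP; rewrite addmC submK // => /xmin.
by rewrite leNgt lt.
Qed.

Lemma sector_le x c c' : (c <= c')%MM -> sector x c' -> sector x c.
Proof.
move=> cc' h x' /h; apply: contra => le; apply: lepm_trans le _.
by apply: lepm_add cc'; apply: lepm_refl.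
Qed.

Lemma sector_inj : injective alpha -> forall x x' c c', sector x c -> sector x' c' ->
  (alpha x + c = alpha x' + c')%MM -> x = x'.
Proof.
move=> inj x x' c c' xc xc' e; apply: contrapT => ne.
have [|/xc'|/xc] := @revlex_total (alpha x) (alpha x'); first by move/inj.
  by rewrite -e lem_addr.
by rewrite e lem_addr.
Qed.

(** If [alpha x] involves the first [p + 1] coordinates only, a generator that
    precedes it in the reverse lexicographic order is at most [alpha x] in all
    coordinates from [p] on, so that only the first [p] coordinates matter. *)
Lemma sector_trunc p x c c' : in_Npow p.+1 (alpha x) -> trunc p c = trunc p c' ->
  sector x c -> sector x c'.
Proof.
move=> xp tcc' xc x' lt; have := xc x' lt; apply: contra => /mnm_lepP le.
apply/mnm_lepP => j; rewrite mnmDE; case: (ltnP j p) => jp.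
  have := congr1 (fun t : 'X_{1..n} => t j) tcc'; rewrite /= !truncE jp => ->.
  by have := le j; rewrite mnmDE.
move/revlexP: lt => [i eqi lti]; apply: leq_trans (leq_addr _ _).
have ip : (i < p.+1)%N by rewrite ltnNge; apply/negP => /xp xi; rewrite xi in lti.
case: (ltngtP i j) => [/eqi ->//|ji|/val_inj <-]; last exact: ltnW.
by move: ip; rewrite ltnS leqNgt (leq_ltn_trans jp ji).
Qed.

Section Level.
Variable p : 'I_n.

(** Above a frontier exponent the diagram starts somewhere in the direction [p],
    and the generators whose last variable is the coordinate [p] act there. Above
    an unreached exponent they never do, so that the corresponding part of a
    remainder is left as it is. *)
Definition frontier : set 'X_{1..n} := [set b | [/\ in_Npow p b, ~ generated b
  & exists k, generated (b + U_(p) *+ k)%MM]].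

Definition unreached : set 'X_{1..n} :=
  [set b | forall k, ~ generated (b + U_(p) *+ k)%MM].

Lemma unreached_le a b : (a <= b)%MM -> unreached b -> unreached a.
Proof.
move=> ab hb k /(generated_le _) h; apply: (hb k); apply: h.
by apply: lepm_add; rewrite ?lepm_refl.
Qed.

Lemma unreached_not_generated a : unreached (trunc p a) -> ~ generated (trunc p.+1 a).
Proof. by move=> h; rewrite truncS_split; apply: h. Qed.

(** Finite type bounds each coordinate [b i] of a frontier exponent: were it large,
    the component along [p] could be traded for it, making [b] itself lie in the
    diagram. *)
Lemma frontier_bounded : finite_type generated ->
  exists M, forall b, frontier b -> (mdeg b < M)%N.
Proof.
move=> fin.
have /choice[e eP] (y : I * 'I_n) : exists e, (y.2 < p)%N ->
    generated [multinom (if l == y.2 then alpha y.1 y.2 + e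
                         else if l == p then 0 else alpha y.1 l)%N | l < n].
  case: (ltnP y.2 p) => [ip|_]; last by exists 0%N.
  have [|e he] := fin y.2 p (alpha y.1) ip; first by exists y.1; apply: lepm_refl.
  by exists e => _.
pose C := (\max_(y : I * 'I_n) (alpha y.1 y.2 + e y))%N.
exists (n * C).+1 => b [bp nb [k [x xb]]]; rewrite ltnS mdegE.
rewrite -[n in (n * C)%N]card_ord -sum_nat_const; apply: leq_sum => i _.
case: (ltnP i p) => [ip|/bp -> //]; rewrite leqNgt; apply/negP => Cb; apply: nb.
apply: generated_le (eP (x, i) ip); apply/mnm_lepP => l; rewrite mnmE /=.
case: eqVneq => [->|li].
  apply: leq_trans (ltnW Cb).
  by rewrite /C (bigD1 (x, i)) //= leq_maxl.
case: eqVneq => // lp; have /mnm_lepP /(_ l) := xb.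
by rewrite mnmDE mnm1nE eq_sym (negPf lp) addn0.
Qed.

(** The diagram is entered above [b] at [b + c e_p]. The multiple by the monomial
    [be] of the generator [x] responsible for this point has it as initial
    exponent, and serves to eliminate the powers of the coordinate [p] from [c] on
    in the coefficient of [b]. *)
Lemma frontierP b : frontier b -> exists (c : nat) x be,
  [/\ (alpha x + be = b + U_(p) *+ c)%MM, sector x be, in_Npow p.+1 (alpha x) &
      forall k, (k < c)%N -> ~ generated (b + U_(p) *+ k)%MM].
Proof.
move=> [bp nb [k0 k0P]].
have ex : exists k, `[< generated (b + U_(p) *+ k)%MM >] by exists k0; apply/asboolP.
case: (ex_minnP ex) => c /asboolP /generatedP [x xb xs] cmin.
exists c, x, (b + U_(p) *+ c - alpha x)%MM; split=> //.
- by rewrite addmC submK.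
- apply: in_Npow_le xb _ => i pi; rewrite mnmDE bp ?(ltnW pi) // mnm1nE.
  by case: eqVneq pi => // ->; rewrite ltnn.
- by move=> k kc gk; move: kc; rewrite ltnNge cmin //; apply/asboolP.
Qed.

End Level.
End Diagrams.

(** * Splitting along a finite set of exponents *)

Section Splitting.
Context {K : fieldType} {E : smooth_data K} (hE : smooth_category E) {n : nat}.
Implicit Types (q r : E n) (a b c : 'X_{1..n}).

(** Germs depending only on the coordinates from [p] on, described by their
    derivatives so as to stay inside a single ring. *)
Definition indep_below p q := forall c, supd q c -> trunc p c = 0%MM.

Lemma indep_below_trunc p q r c : indep_below p q -> supd (q * r) c ->
  exists2 a, supd r a & trunc p c = trunc p a.
Proof.
move=> qp /(supd_mul hE) [a [b [-> /qp a0 rb]]]; exists b => //.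
by rewrite truncD a0 add0m.
Qed.

Lemma hasse_monom_indep p b q : in_Npow p b -> indep_below p q ->
  hasse b (monom b * q) = q.
Proof.
move=> bp qp; rewrite sc_hasseM //.
have bb : (mdeg b < (mdeg b).+1)%N by [].
rewrite (bigD1 (BMultinom bb, bm0)) /=; last by rewrite addm0.
rewrite hasse_monom_same // sc_hasse0 // mul1r big1 ?addr0 // => -[k1 k2] /= /andP[/eqP bE ne].
case: (eqVneq (hasse k2 q) 0) => [->|nz]; first exact: mulr0.
have k20 : bmnm k2 = 0%MM.
  rewrite -(qp _ nz); apply/esym/trunc_Npow; apply: in_Npow_le bp.
  by rewrite [in X in (_ <= X)%MM]bE lem_addl.
case/eqP: ne; congr pair; apply: val_inj => //=.
by rewrite [in RHS]bE k20 addm0.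
Qed.

(** Peel off an exponent [b] of maximal degree in [L]: as no larger exponent
    remains, the derivative [hasse b r] is independent of the first [p]
    coordinates, and it is the coefficient of [monom b] in [r]. *)
Lemma split_supd p (Phi : set 'X_{1..n}) (L : seq 'X_{1..n}) r :
  uniq L -> (forall b, b \in L -> in_Npow p b /\ ~ Phi b) ->
  (forall a b, (a <= b)%MM -> Phi b -> Phi a) ->
  (forall a b, (a <= b)%MM -> b \in L -> a \in L \/ Phi a) ->
  (forall c, supd r c -> trunc p c \in L \/ Phi (trunc p c)) ->
  exists (q : 'X_{1..n} -> E n) r0, [/\ forall b, indep_below p (q b),
    r = \sum_(b <- L) monom b * q b + r0 & forall c, supd r0 c -> Phi (trunc p c)].
Proof.
move=> uL LP Phi_le; move sL : (size L) => N; elim: N => [|N IH] in L r uL LP sL *.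
  move/size0nil: sL => -> _ rL; exists (fun=> 0), r; split.
  - by move=> b c /supd0.
  - by rewrite big_nil add0r.
  - by move=> c /rL [].
move=> L_le rL.
have [b bL bmax] : exists2 b, b \in L & forall b', b' \in L -> (mdeg b' <= mdeg b)%N.
  have ex : exists k, has (fun b => mdeg b == k) L.
    by case: L sL {uL LP L_le rL} => //= b L' _; exists (mdeg b); rewrite eqxx.
  have ub k : has (fun b => mdeg b == k) L -> (k <= \sum_(b <- L) mdeg b)%N.
    by case/hasP => b bL /eqP <-; rewrite (big_rem b) //= leq_addr.
  case: (ex_maxnP ex ub) => k /hasP[b bL /eqP bk] kmax; exists b => // b' b'L.
  by rewrite bk; apply: kmax; apply/hasP; exists b'.
have [bp nPb] := LP b bL.
set q := hasse b r.
have qp : indep_below p q.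
  move=> c qc; apply/eqP; apply: contrapT => /negP c0.
  have : supd r (c + b)%MM.
    by apply: contra_neq qc; rewrite /q sc_hasse_iter // => ->; rewrite mul0rn.
  move/rL; rewrite truncD ((trunc_Npow _ _).1 bp) => -[/bmax|/(Phi_le _ _ (lem_addl _ _))//].
  by rewrite mdegD -[X in (_ <= X)%N]add0n leq_add2r leqn0 mdeg_eq0 (negPf c0).
have rE : r = monom b * q + (r - monom b * q) by rewrite addrC subrK.
have [q' [r0 [q'p r'E r0P]]] : exists (q' : 'X_{1..n} -> E n) r0,
    [/\ forall b, indep_below p (q' b),
    r - monom b * q = \sum_(b <- rem b L) monom b * q' b + r0
    & forall c, supd r0 c -> Phi (trunc p c)].
  apply: IH.
  - exact: rem_uniq.
  - by move=> c /mem_rem /LP.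
  - by rewrite size_rem // sL.
  - move=> a c ac cL; have [|aL|] := L_le a c ac; [exact: mem_rem cL| |by right].
    left; rewrite rem_filter // mem_filter aL andbT /=.
    apply/negP => /eqP ab; move: cL; rewrite rem_filter // mem_filter => /andP[/= cb /bmax].
    move: ac; rewrite ab => bc; rewrite -(submK bc) mdegD -[X in (_ <= X)%N]add0n leq_add2r leqn0.
    rewrite mdeg_eq0 => /eqP cb0; case/eqP: cb.
    by rewrite -(submK bc) cb0 add0m.
  - move=> c rc.
    have [|] : trunc p c \in L \/ Phi (trunc p c); last by right.
      case: (supdB rc) => [/rL //|/(supd_mul hE) [a [c' [cE /(supd_monom hE) ab /qp c'0]]]].
      apply: L_le bL; rewrite cE truncD c'0 addm0.
      exact: lepm_trans (trunc_le _ _) ab.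
    move=> cL; left; rewrite rem_filter // mem_filter cL andbT /=.
    apply/negP => /eqP cb; case/negP: rc.
    have bc : (b <= c)%MM by rewrite -cb trunc_le.
    rewrite -(submK bc) -hasseD_disjoint //.
      rewrite raddfB /= (hasse_monom_indep bp qp) -/q subrr raddf0 //.
    move=> i; case: (ltnP i p) => ip; last by right; apply: bp.
    by left; rewrite mnmBE -cb truncE ip subnn.
exists (fun c => if c == b then q else q' c), r0; split=> //.
  by move=> c; case: eqP.
rewrite [LHS]rE r'E [in RHS](big_rem b bL) /= [b == b]eqxx addrA; congr (_ + _ + _).
apply: eq_big_seq => c; rewrite rem_filter // mem_filter => /andP[/= /negPf -> _] //.
Qed.

End Splitting.

(** * Existence of the division *)

Section LeftPart.
Context {n m : nat}.
Implicit Types (a : 'X_{1..n}) (c : 'X_{1..n + m}).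

Lemma lpartE c i : lpart c i = c (lshift m i).
Proof. exact: mnmE. Qed.

Lemma lpartD c c' : lpart (c + c')%MM = (lpart c + lpart c')%MM.
Proof. by apply/mnmP => i; rewrite mnmDE !lpartE mnmDE. Qed.

Lemma lpart_le c c' : (c <= c')%MM -> (lpart c <= lpart c')%MM.
Proof. by move=> /mnm_lepP h; apply/mnm_lepP => i; rewrite !lpartE. Qed.

Lemma lpart_trunc p c : lpart (trunc p c) = trunc p (lpart c).
Proof. by apply/mnmP => i; rewrite lpartE !truncE lpartE. Qed.

Lemma trunc_lext p c : (p <= n)%N -> trunc p c = lext m (trunc p (lpart c)).
Proof.
move=> pn; apply/mnmP => i; rewrite truncE -[i]splitK; case: (split i) => j /=.
  by rewrite lext_l truncE lpartE.
by rewrite lext_r ltnNge (leq_trans pn) // leq_addr.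
Qed.

Lemma in_Npow_lext p a : in_Npow p a -> in_Npow p (lext m a).
Proof.
move=> ap i; rewrite -[i]splitK; case: (split i) => j /=; last by rewrite lext_r.
by rewrite lext_l; apply: ap.
Qed.

Lemma le_lext a c : (c <= lext m a)%MM -> c = lext m (lpart c) /\ (lpart c <= a)%MM.
Proof.
move=> ca; split; last by rewrite -[a](@lextK n m) lpart_le.
apply/mnmP => i; rewrite -[i]splitK; case: (split i) => j /=.
  by rewrite lext_l lpartE.
by rewrite lext_r; apply/eqP; rewrite -leqn0 -(lext_r a j); move/mnm_lepP: ca.
Qed.

Lemma lpart_mnm1n (p : 'I_n) k : lpart (U_(lshift m p) *+ k)%MM = (U_(p) *+ k)%MM.
Proof. by apply/mnmP => i; rewrite lpartE !mnm1nE (inj_eq (@lshift_inj _ _)). Qed.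

Lemma lextD a a' : lext m (a + a')%MM = (lext m a + lext m a')%MM.
Proof.
by apply/mnmP => i; rewrite mnmDE !lextE; case: (split i) => // j; rewrite mnmDE.
Qed.

Lemma lext_mnm1n (p : 'I_n) k : lext m (U_(p) *+ k)%MM = (U_(lshift m p) *+ k)%MM.
Proof.
apply/mnmP => i; rewrite lextE mnm1nE -[i in RHS]splitK; case: (split i) => j /=.
  by rewrite mnm1nE (inj_eq (@lshift_inj _ _)).
by rewrite eq_lrshift.
Qed.

End LeftPart.

Lemma trunc_mnm1n n p (i : 'I_n) e : (p <= i)%N -> trunc p (U_(i) *+ e)%MM = 0%MM.
Proof.
move=> pi; apply/mnmP => j; rewrite truncE mnm0E mnm1nE.
by case: ltnP => // jp; case: eqVneq => // ij; move: jp; rewrite -ij ltnNge pi.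
Qed.

Lemma restrict_monom (K : fieldType) (E : smooth_data K) (hE : smooth_category E)
  n m (a : 'X_{1..n}) : restrict E n m (monom (lext m a)) = monom a.
Proof.
rewrite rmorph_prod /= big_split_ord /= [X in _ * X]big1 ?mulr1 => [|j _].
  apply: eq_bigr => j _.
  by rewrite rmorphXn /= restrict_coord // (unsplitK (inl j)) lext_l.
by rewrite lext_r expr0 rmorph1.
Qed.

Lemma incl_comp (K : fieldType) (E : smooth_data K) (hE : smooth_category E)
    k l n (sigma : 'I_l -> 'I_n) (tau : 'I_k -> 'I_l) q :
  incl E sigma (incl E tau q) = incl E (sigma \o tau) q.
Proof.
rewrite /incl pullback_comp // => [|i|i]; try exact: at0_coord.
congr (pullback _ q); apply/funext => i.
by rewrite pullback_coord // => j; exact: at0_coord.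
Qed.

Section Existence.
Context {K : fieldType} {E : smooth_data K} (hE : smooth_category E).
Context {R : realType} {k n m : nat} {T : 'M[R]_(k.+1, n)}.
Hypothesis hT : normalized_grading T.
Context {I : finType} {alpha : I -> 'X_{1..n}} {f : I -> E (n + m)%N}.
Hypothesis alpha_inj : injective alpha.
Hypothesis f_exp : forall x, is_exp T (restrict E n m (f x)) (Some (alpha x)).
Hypothesis fin_type : finite_type (generated alpha).

Let f_lead x : coeff (restrict E n m (f x)) (alpha x) != 0.
Proof. exact: (f_exp x).1. Qed.

Let f_tail x b : coeff (restrict E n m (f x)) b != 0 -> b <> alpha x ->
  (grade T (alpha x) < grade T b)%O.
Proof. exact: (f_exp x).2. Qed.

(** Division by the generators supported in the first [p] coordinates only. *)
Definition partial_division (p : nat) (g : E (n + m)%N) : Prop :=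
  exists (h : I -> E (n + m)%N) r, [/\ g = \sum_x h x * f x + r,
    forall x c, supd (h x) c -> sector alpha x (lpart c),
    forall x, ~ in_Npow p (alpha x) -> h x = 0
  & forall c, supd r c -> ~ generated alpha (trunc p (lpart c))].

(** A generator without variables has a unit [f x], and divides everything. *)
Lemma partial_division0 g : partial_division 0 g.
Proof.
have [[x x0]|no0] := pselect (exists x, alpha x = 0%MM).
  have fu : f x \is a GRing.unit.
    apply: at0_unit => //; rewrite -(at0_restrict hE) at0E -x0; exact: f_lead.
  exists (fun x' => if x' == x then g / f x else 0), 0; split.
  - rewrite (bigD1 x) //= eqxx divrK // big1 ?addr0 // => x' /negPf ->.
    by rewrite mul0r.
  - move=> x' c; case: eqVneq => [-> _|_ /supd0 //] x'' /revlexP [i _].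
    by rewrite x0 mnm0E.
  - by move=> x'; case: eqVneq => // -> []; rewrite x0 => i _; rewrite mnm0E.
  - by move=> c /supd0.
exists (fun=> 0), g; split=> //.
- by rewrite big1 ?add0r // => x _; rewrite mul0r.
- by move=> x c /supd0.
- move=> c _ [x]; rewrite trunc0_eq0 => /mnm_lepP x0; apply: no0; exists x.
  by apply/mnmP => i; apply/eqP; rewrite mnm0E -leqn0; have := x0 i; rewrite mnm0E.
Qed.

Section Step.
Variables (p : 'I_n) (P : nat) (b : 'I_P -> 'X_{1..n}).
Hypothesis b_inj : injective b.
Hypothesis bP : forall a, frontier alpha p a <-> exists y, b y = a.
Variables (c : 'I_P -> nat) (x_ : 'I_P -> I) (be : 'I_P -> 'X_{1..n}).
Hypothesis dataP : forall y, [/\ (alpha (x_ y) + be y = b y + U_(p) *+ c y)%MM,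
  sector alpha (x_ y) (be y), in_Npow p.+1 (alpha (x_ y))
  & forall k, (k < c y)%N -> ~ generated alpha (b y + U_(p) *+ k)%MM].
Hypothesis IH : forall g, partial_division p g.

Let frontier_b y : frontier alpha p (b y).
Proof. by apply/bP; exists y. Qed.

Let b_Npow y : in_Npow p (b y).
Proof. by case: (frontier_b y). Qed.

Let trunc_b y : trunc p (b y) = b y.
Proof. exact/trunc_Npow. Qed.

Let frontier_or_unreached a : in_Npow p a -> ~ generated alpha a ->
  (exists y, b y = a) \/ unreached alpha p a.
Proof.
move=> ap ng; have [|nr] := pselect (unreached alpha p a); [by right|left].
by apply/bP; split=> //; move/existsNP: nr => [k' /contrapT]; exists k'.
Qed.

Lemma split_frontier r :
  (forall a, supd r a -> ~ generated alpha (trunc p (lpart a))) ->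
  exists (q : 'I_P -> E (n + m)%N) r0, [/\ forall y, indep_below p (q y),
    r = \sum_y monom (lext m (b y)) * q y + r0
  & forall a, supd r0 a -> unreached alpha p (trunc p (lpart a))].
Proof.
move=> rP; pose L := [seq lext m (b y) | y <- enum 'I_P].
have LP a : a \in L <-> exists y, lext m (b y) = a.
  split=> [/mapP[y _ ->]|[y <-]]; first by exists y.
  by apply: map_f; rewrite mem_enum.
have pn : (p <= n)%N by apply: ltnW.
have [|||||q [r0 [qp rE r0P]]] :=
    @split_supd _ _ hE _ p [set a | unreached alpha p (lpart a)] L r.
- rewrite map_inj_uniq ?enum_uniq // => y y' /(congr1 (@lpart n m)).
  by rewrite !lextK => /b_inj.
- move=> a /LP[y <-]; split; first exact/in_Npow_lext.
  by rewrite /= lextK => h; have [_ _ [k' /h]] := frontier_b y.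
- by move=> a a' aa' /=; apply/unreached_le/lpart_le.
- move=> a a' aa' /LP[y a'E]; have [|aE ay] := @le_lext n m (b y) a; first by rewrite a'E.
  have [||[y' y'a]|] := @frontier_or_unreached (lpart a); last by right.
  + exact: in_Npow_le ay (b_Npow y).
  + by move/(generated_le ay); have [] := frontier_b y.
  + by left; apply/LP; exists y'; rewrite y'a -aE.
- move=> a /rP ng; rewrite /= lpart_trunc trunc_lext //.
  have [||[y' y'a]|] := @frontier_or_unreached (trunc p (lpart a)) => //; last by right.
  + exact: in_Npow_trunc.
  + by left; apply/LP; exists y'; rewrite y'a.
exists (fun y => q (lext m (b y))), r0; split=> //.
  by rewrite rE big_map big_enum.
by move=> a /r0P /=; rewrite lpart_trunc.
Qed.

Let l := (n + m - p.+1)%N.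

Fact shift_subproof (j : 'I_l.+1) : (p + j < n + m)%N.
Proof. by have := ltn_ord j; have := ltn_ord p; rewrite /l; lia. Qed.

Let sigma (j : 'I_l.+1) : 'I_(n + m) := Ordinal (shift_subproof j).

Let sigma_inj : injective sigma.
Proof. by move=> i j /(congr1 val) /= /addnI /val_inj. Qed.

Let sigma0 : sigma ord0 = lshift m p.
Proof. by apply: val_inj; rewrite /= addn0. Qed.

Let incl_indep q : indep_below p (incl E sigma q).
Proof.
move=> a qa; apply/mnmP => i; rewrite truncE mnm0E; case: ifP => // ip.
apply: (supd_incl hE sigma_inj _ qa) => j.
by rewrite -val_eqE /= neq_ltn orbC (leq_trans ip) ?leq_addr.
Qed.

Let incl_lift_indep q : indep_below p.+1 (incl E sigma (incl E (lift ord0) q)).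
Proof.
rewrite incl_comp // => a qa; apply/mnmP => i; rewrite truncE mnm0E; case: ifP => // ip.
apply: (supd_incl hE _ _ qa) => [|j]; first exact: inj_comp sigma_inj (@lift_inj _ _).
rewrite -val_eqE /= neq_ltn orbC (leq_trans ip) //.
by rewrite /bump /= addnS ltnS leq_addr.
Qed.

Let indep_incl q : indep_below p q -> exists q', q = incl E sigma q'.
Proof.
move=> qp; apply/(sc_incl_image hE sigma_inj) => i e hi e0.
apply/eqP; apply: contrapT => /negP /qp /(congr1 (fun a : 'X_{1..n + m} => a i)).
rewrite /= truncE mnm0E mnm1nE eqxx; case: ltnP => [_ e00|pi]; first by rewrite e00 in e0.
have lt : (i - p < l.+1)%N by have := ltn_ord i; have := ltn_ord p; move: pi; rewrite /l; lia.
have /eqP [] := hi (Ordinal lt); apply: val_inj; rewrite /= subnKC //.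
Qed.

Let row_eq (y : 'I_P) (hh : I -> E (n + m)%N) (q : 'I_P -> E (n + m)%N) r0 :=
  monom (lext m (be y)) * f (x_ y) =
  \sum_x hh x * f x + (\sum_y' monom (lext m (b y')) * q y' + r0).

(** The row of the frontier exponent [b y]: a monomial multiple of a generator,
    reduced by the generators in the first [p] coordinates and expanded along the
    frontier. Its unreached part [r0] goes to the remainder. *)
Let row_division y : exists hh q r0, [/\ row_eq y hh q r0,
  forall x a, supd (hh x) a -> sector alpha x (lpart a),
  forall x, ~ in_Npow p (alpha x) -> hh x = 0,
  forall y', indep_below p (q y')
  & forall a, supd r0 a -> unreached alpha p (trunc p (lpart a))].
Proof.
have [hh [r [rE hs h0 rs]]] := IH (monom (lext m (be y)) * f (x_ y)).
have [q [r0 [qp rE' r0s]]] := split_frontier rs.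
by exists hh, q, r0; split=> //; rewrite /row_eq rE -rE'.
Qed.

Let trunc_front y e : trunc p (b y + U_(p) *+ e)%MM = b y.
Proof. by rewrite truncD trunc_b trunc_mnm1n // addm0. Qed.

(** The leading exponent of the [y]-th row sits on the diagonal: it is not
    divisible by any generator used to reduce the row, and reducing the larger
    terms only creates larger ones. *)
Let row_weights y hh q r0 : row_eq y hh q r0 ->
  (forall x a, supd (hh x) a -> sector alpha x (lpart a)) ->
  (forall x, ~ in_Npow p (alpha x) -> hh x = 0) ->
  (forall y', indep_below p (q y')) ->
  (forall a, supd r0 a -> unreached alpha p (trunc p (lpart a))) ->
  coeff (q y) (U_(lshift m p) *+ c y)%MM != 0 /\
  forall y' e, coeff (q y') (U_(lshift m p) *+ e)%MM != 0 ->
    (y', e) = (y, c y) \/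
    (grade T (b y + U_(p) *+ c y)%MM < grade T (b y' + U_(p) *+ e)%MM)%O.
Proof.
move=> rowE hs h0 qp r0s.
have [dE xs xp low] := dataP y.
set lead := (b y + U_(p) *+ c y)%MM in dE *.
pose rr := \sum_y' monom (lext m (b y')) * q y' + r0.
have rr_coeff y' e : coeff (restrict E n m rr) (b y' + U_(p) *+ e)%MM =
    coeff (q y') (U_(lshift m p) *+ e)%MM.
  rewrite coeff_restrict // lextD lext_mnm1n coeffD [coeff r0 _](_ : _ = 0).
    rewrite addr0 coeff_sum (bigD1 y') //= big1 ?addr0.
      by rewrite mulrC coeff_mul_monom // lem_addr addmC addmK.
    move=> z zy'; rewrite mulrC coeff_mul_monom //; case: ifP => // le.
    apply: contraNeq zy' => /(supd_coeff hE) /qp e0.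
    apply/eqP/b_inj; rewrite -[b z](@lextK n m) -[RHS](@lextK n m); congr lpart.
    have := congr1 (trunc p) (submK le); rewrite truncD e0 add0m truncD.
    rewrite [trunc p (_ *+ _)%MM]trunc_mnm1n //= addm0.
    by rewrite !((trunc_Npow _ _).1 (in_Npow_lext _)).
  apply/eqP; apply: contrapT => /negP /(supd_coeff hE) /r0s.
  rewrite lpartD lextK lpart_mnm1n trunc_front => h.
  by have [_ _ [e' /h]] := frontier_b y'.
pose lam := coeff (restrict E n m (f (x_ y))) (alpha (x_ y)).
have eq0 : monom (be y) * restrict E n m (f (x_ y)) - lam *: monom lead =
    \sum_x restrict E n m (hh x) * restrict E n m (f x) +
    (restrict E n m rr - lam *: monom lead).
  rewrite addrA; congr (_ - _); have := congr1 (restrict E n m) rowE.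
  rewrite rmorphM /= restrict_monom // => ->; rewrite rmorphD rmorph_sum; congr (_ + _).
  by apply: eq_bigr => x _; rewrite rmorphM.
have hs' x a : coeff (restrict E n m (hh x)) a != 0 -> sector alpha x a.
  by rewrite coeff_restrict // => /(supd_coeff hE) /hs; rewrite lextK.
have hp x a : coeff (restrict E n m (hh x)) a != 0 -> in_Npow p (alpha x).
  by move=> nz; apply: contrapT => /h0 hx; move: nz; rewrite hx raddf0 coeff0 eqxx.
have unreached_ng a : unreached alpha p a -> ~ generated alpha a.
  by move/(_ 0%N); rewrite mulm0n addm0.
have rr_ng a : coeff (restrict E n m rr) a != 0 -> ~ generated alpha (trunc p a).
  rewrite coeff_restrict // => /(supd_coeff hE) /supdD [|/r0s]; last first.
    by rewrite lextK; apply: unreached_ng.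
  move=> /supd_sum [y' [_ _ /(supd_mul hE) [a1 [a2 [aE /(supd_monom hE) a1b /qp a20]]]]].
  have [_ ng _] := frontier_b y'; apply: contra_not ng; apply: generated_le.
  rewrite -[a](@lextK n m) aE -lpart_trunc truncD a20 addm0 -[b y'](@lextK n m).
  apply: lpart_le.
  exact: lepm_trans (trunc_le _ _) a1b.
have lead_coeff a : coeff (restrict E n m rr - lam *: monom lead) a =
    coeff (restrict E n m rr) a - (if a == lead then lam else 0).
  rewrite coeffB coeffZ coeff_monom //.
  by case: eqP; rewrite ?mulr1 ?mulr0.
have below_trunc x a a' : in_Npow p (alpha x) -> (alpha x <= a)%MM ->
    trunc p a = a' -> generated alpha a'.
  move=> /trunc_Npow xp' xa <-; exists x; rewrite -[X in (X <= _)%MM]xp'.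
  exact: truncS.
have [||||] := @division_weights _ _ _ _ _ (grade T) I alpha
    (restrict E n m \o f) (restrict E n m \o hh) _ _ (wf_grade hT)
    (grade_additive (T := T)) eq0 f_lead f_tail _ _ (fun o => (grade T lead < o)%O).
- by move=> x x' a a' /hs' h1 /hs' h2; apply: sector_inj alpha_inj _ _ _ _ h1 h2.
- move=> x a nz; rewrite lead_coeff ifN.
    rewrite subr0; apply/eqP; apply: contrapT => /negP /rr_ng; apply.
    exact: below_trunc (hp _ _ nz) (lem_addr _ a) _.
  apply/eqP => e; have [_ ng _] := frontier_b y; apply: ng.
  apply: (below_trunc x lead); [exact: hp nz | by rewrite -e lem_addr | exact: trunc_front].
- by move=> o o' oo' lt; apply: lt_le_trans oo'.
- move=> a; rewrite coeffB coeffZ coeff_monom // mulrC coeff_mul_monom //.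
  case: ifP => [le|nle]; last first.
    rewrite sub0r oppr_eq0; case: (eqVneq a lead) => [aE|_]; last by rewrite mulr0n mulr0 eqxx.
    by move: nle; rewrite aE -dE lem_addl.
  case: (eqVneq (a - be y)%MM (alpha (x_ y))) => [aE|ne].
    by rewrite aE -(submK le) aE dE eqxx mulr1 subrr eqxx.
  have /negPf -> : a != lead by apply: contra_neq ne => ->; rewrite -dE addmK.
  rewrite mulr0n mulr0 subr0 => nz; rewrite -dE -[X in (_ < grade T X)%O](submK le).
  by apply: grade_additive; apply: f_tail nz _; apply/eqP.
move=> above _.
have rr_lead : coeff (restrict E n m rr) lead = lam.
  apply/eqP; apply: contrapT => /negP ne; have := above lead.
  by rewrite lead_coeff eqxx subr_eq0 ltxx => /(_ ne).
split; first by rewrite -rr_coeff rr_lead f_lead.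
move=> y' e; rewrite -rr_coeff => nz.
case: (eqVneq (b y' + U_(p) *+ e)%MM lead) => [eE|ne]; last first.
  by right; apply: above; rewrite lead_coeff (negPf ne) subr0.
left; have := congr1 (trunc p) eE; rewrite !trunc_front => /b_inj y'y.
congr pair => //; have := congr1 (fun a : 'X_{1..n} => a p) eE.
by rewrite /= y'y !mnmDE !mnm1nE eqxx => /addnI.
Qed.

(** One Weierstrass division, by the matrix of all rows at once, removes the
    multiples of the generators involving the coordinate [p] in an essential
    way. *)
Lemma partial_divisionS g : partial_division p.+1 g.
Proof.
have /choice[D DP] y : exists D : (I -> E (n + m)%N) * ('I_P -> E (n + m)%N) * E (n + m)%N,
    [/\ row_eq y D.1.1 D.1.2 D.2,
      forall x a, supd (D.1.1 x) a -> sector alpha x (lpart a),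
      forall x, ~ in_Npow p (alpha x) -> D.1.1 x = 0,
      forall y', indep_below p (D.1.2 y')
    & forall a, supd D.2 a -> unreached alpha p (trunc p (lpart a))].
  by have [hh [q [r0 h]]] := row_division y; exists (hh, q, r0).
have /choice[F FE] (z : 'I_P * 'I_P) : exists q', (D z.1).1.2 z.2 = incl E sigma q'.
  by apply: indep_incl; have [_ _ _ h _] := DP z.1.
pose Fm : 'M[E l.+1]_P := \matrix_(y, y') F (y, y').
have FmE y y' : (D y).1.2 y' = incl E sigma (Fm y y') by rewrite mxE -FE.
have [h [r [gE hs h0 rs]]] := IH g.
have [qg [rg [qgp rE rgs]]] := split_frontier rs.
have /choice[G GE] y : exists q', qg y = incl E sigma q' by apply: indep_incl.
have Fcoeff y y' e : coeff (Fm y y') (U_(ord0) *+ e)%MM =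
    coeff ((D y).1.2 y') (U_(lshift m p) *+ e)%MM.
  by rewrite FmE -sigma0 -mnm_pushU coeff_incl.
have lead y : coeff (Fm y y) (U_(ord0) *+ c y)%MM != 0.
  by have [e1 e2 e3 e4 e5] := DP y; rewrite Fcoeff; have [] := row_weights e1 e2 e3 e4 e5.
have tail y y' e : coeff (Fm y y') (U_(ord0) *+ e)%MM != 0 -> (y', e) = (y, c y) \/
    (grade T (b y + U_(p) *+ c y)%MM < grade T (b y' + U_(p) *+ e)%MM)%O.
  have [e1 e2 e3 e4 e5] := DP y; rewrite Fcoeff.
  by have [_] := row_weights e1 e2 e3 e4 e5; apply.
have [||h' [s GsE]] := @matrix_weierstrass_division _ _ hE _ _ _ _ _ _
    (fun y e => grade T (b y + U_(p) *+ e)%MM) _ _ lead tail (\row_y G y).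
- move=> y e y' e' lt; rewrite !mulmSr !addmA; exact: grade_additive.
- move=> y e; exists (mdeg (b y) + e).+1 => y' e' lt; apply: grade_lt_mdeg => //.
  by rewrite !mdegD !mdegMn !mdeg1 !mul1n (leq_trans lt) // leq_addl.
pose H y := incl E sigma (h' 0 y).
have Hp y : indep_below p (H y) by apply: incl_indep.
pose t : E (n + m)%N := coord E (lshift m p).
pose S y e := incl E sigma (incl E (lift ord0) (s y e)).
have Sp y e : indep_below p.+1 (S y e) by apply: incl_lift_indep.
have qgE y : qg y = \sum_y' H y' * (D y').1.2 y + \sum_(e < c y) S y e * t ^+ e.
  have := congr1 (fun M : 'rV_P => incl E sigma (M 0 y)) GsE.
  rewrite !mxE /= -GE => ->; rewrite rmorphD !rmorph_sum; congr (_ + _).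
    by apply: eq_bigr => y' _; rewrite rmorphM FmE.
  by apply: eq_bigr => e _; rewrite rmorphM rmorphXn /= incl_coord // sigma0.
(* Replace each row occurring in the matrix division by the combination of
   generators that it stands for. *)
exists (fun x => h x + \sum_y ((if x_ y == x then H y * monom (lext m (be y)) else 0)
    - H y * (D y).1.1 x)).
exists (\sum_y monom (lext m (b y)) * (\sum_(e < c y) S y e * t ^+ e) + rg
  - \sum_y H y * (D y).2); split.
- have -> : \sum_x (h x + \sum_y ((if x_ y == x then H y * monom (lext m (be y)) else 0)
      - H y * (D y).1.1 x)) * f x = \sum_x h x * f x +
      \sum_y H y * (\sum_y' monom (lext m (b y')) * (D y).1.2 y' + (D y).2).
    under eq_bigr => x _ do rewrite mulrDl mulr_suml.
    rewrite big_split /= exchange_big; congr (_ + _); apply: eq_bigr => y _.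
    under eq_bigr => x _ do rewrite mulrBl.
    rewrite sumrB (bigD1 (x_ y)) //= eqxx big1 ?addr0 => [|x xx]; last first.
      by rewrite eq_sym (negPf xx) mul0r.
    have [rowE _ _ _ _] := DP y.
    under eq_bigr => x _ do rewrite -mulrA.
    by rewrite -mulrA -mulr_sumr -mulrBr rowE [X in X - _]addrC addrK.
  have rE' : r = \sum_y H y * (\sum_y' monom (lext m (b y')) * (D y).1.2 y') +
      (\sum_y monom (lext m (b y)) * (\sum_(e < c y) S y e * t ^+ e) + rg).
    rewrite rE addrA; congr (_ + _); under eq_bigr => y _ do rewrite qgE mulrDr.
    rewrite big_split /=; congr (_ + _).
    under eq_bigr => y _ do rewrite mulr_sumr.
    rewrite exchange_big; apply: eq_bigr => y _; rewrite mulr_sumr.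
    by apply: eq_bigr => y' _; rewrite mulrCA.
  under [X in _ = _ + X + _]eq_bigr => y _ do rewrite mulrDr.
  rewrite gE rE' big_split /= -!addrA; congr (_ + (_ + _)).
  by rewrite [RHS]addrC -!addrA addNr addr0.
- move=> x a /supdD [/hs //|/supd_sum [y [_ _ /supdB [|]]]].
    case: eqP => [<-|_ /supd0 //].
    case/(indep_below_trunc hE (Hp y)) => a' /(supd_monom hE) a'be aa'.
    have [_ xs xp _] := dataP y.
    apply: (sector_trunc xp (c := lpart a')); first by rewrite -!lpart_trunc aa'.
    by apply: sector_le xs; rewrite -[be y](@lextK n m) lpart_le.
  have [_ hhs hh0 _ _] := DP y.
  have [xp|/hh0 ->] := pselect (in_Npow p (alpha x)); last by rewrite mulr0 => /supd0.
  case/(indep_below_trunc hE (Hp y)) => a' /hhs a's aa'.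
  apply: (sector_trunc (p := p) _ _ a's); first exact: in_Npow_leq xp.
  by rewrite -!lpart_trunc aa'.
- move=> x xp; have xp' : ~ in_Npow p (alpha x) by apply: contra_not xp; apply: in_Npow_leq.
  rewrite h0 // add0r big1 // => y _; have [_ _ hh0 _ _] := DP y.
  rewrite hh0 // mulr0 subr0; case: eqP => // xE; case: xp; rewrite -xE.
  by have [] := dataP y.
- move=> a /supdB [/supdD [|/rgs]|]; last 1 first.
  + case/supd_sum => y [_ _ /(indep_below_trunc hE (Hp y)) [a' ra' aa']].
    have [_ _ _ _ /(_ _ ra')] := DP y; rewrite -lpart_trunc -aa' lpart_trunc.
    exact: unreached_not_generated.
  + case/supd_sum => y [_ _]; rewrite mulr_sumr => /supd_sum [e [_ _]].
    case/(supd_mul hE) => a1 [a2 [-> /(supd_monom hE) a1b]].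
    case/(indep_below_trunc hE (Sp y e)) => a3 a3t a23.
    have [_ _ _ /(_ e (ltn_ord e)) ng] := dataP y; apply: contra_not ng.
    apply: generated_le; rewrite -lpart_trunc truncD a23 -truncD.
    have : (a1 + a3 <= lext m (b y + U_(p) *+ e)%MM)%MM.
      rewrite lextD lext_mnm1n; apply: lepm_add a1b _; apply: (supd_monom hE).
      by rewrite monomUn.
    move=> le; rewrite -[X in (_ <= X)%MM](@lextK n m); apply: lpart_le.
    exact: lepm_trans (trunc_le _ _) le.
  + exact: unreached_not_generated.
Qed.

End Step.

(** The frontier is finite, so that its exponents index the rows of a square
    matrix. *)
Lemma partial_division_exists p g : (p <= n)%N -> partial_division p g.
Proof.
elim: p g => [|p IH] g; first by move=> _; apply: partial_division0.
move=> pn; pose p' := Ordinal pn.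
have [M Mbound] := frontier_bounded p' fin_type.
pose B := [set b : 'X_{1..n < M} | `[< frontier alpha p' b >]]%SET.
pose b (y : 'I_#|B|) : 'X_{1..n} := enum_val y.
have b_inj : injective b by move=> y y' /val_inj /enum_val_inj.
have bP a : frontier alpha p' a <-> exists y, b y = a.
  split=> [fa|[y <-]]; last by have := enum_valP y; rewrite inE => /asboolP.
  have aB : BMultinom (Mbound _ fa) \in B by rewrite inE; apply/asboolP.
  by exists (enum_rank_in aB (BMultinom (Mbound _ fa))); rewrite /b enum_rankK_in.
have /choice[d dP] y : exists d : nat * I * 'X_{1..n},
    [/\ (alpha d.1.2 + d.2 = b y + U_(p') *+ d.1.1)%MM, sector alpha d.1.2 d.2,
      in_Npow p.+1 (alpha d.1.2)
    & forall e, (e < d.1.1)%N -> ~ generated alpha (b y + U_(p') *+ e)%MM].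
  have [|e [x [be h]]] := @frontierP n I alpha p' (b y); first by apply/bP; exists y.
  by exists (e, x, be).
apply: (@partial_divisionS p' _ b b_inj bP _ _ _ dP) => g'.
by apply: IH; apply: ltnW.
Qed.

End Existence.

(** * Uniqueness and estimates *)

Section Orders.
Context {K : fieldType} {E : smooth_data K} (hE : smooth_category E) {R : realType}.

Lemma ord_sub_le n n' (g : E n) (h : E n') (a : nat) :
  (forall k, ideal_exp (maxid E n) k g -> ideal_exp (maxid E n') (k - a) h) ->
  (ord R g - (a%:R)%:E <= ord R h)%E.
Proof.
move=> gh; rewrite leeBlDr //; apply: ge_ereal_sup => _ [k kg <-].
apply: (@le_trans _ _ (((k - a)%:R)%:E + (a%:R)%:E)%E).
  rewrite -EFinD lee_fin -natrD Num.Theory.ler_nat; lia.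
by apply: leeD => //; apply: ereal_sup_ubound; exists (k - a)%N => //; apply: gh.
Qed.

Lemma ord_coeff n (f : E n) (a : nat) c : ord R f = (a%:R)%:E -> coeff f c != 0 ->
  (a <= mdeg c)%N.
Proof.
move=> fa fc; rewrite -(Num.Theory.ler_nat R) -lee_fin -fa.
apply: ge_ereal_sup => _ [k /(sc_taylor_exp hE) kf <-].
by rewrite lee_fin Num.Theory.ler_nat leqNgt; apply: contra_neqN fc => /kf.
Qed.

Lemma reduced_eq0 n (f : E n) : reduced E -> (forall c, coeff f c = 0) -> f = 0.
Proof. by move=> red f0; apply: red; apply/(sc_taylor_ker hE)/fpsP. Qed.

End Orders.

Lemma additive_weight_lexi (disp : Order.disp_t) (O : orderType disp) n
    (v : 'X_{1..n} -> nat) (w : 'X_{1..n} -> O) :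
  (forall a b, v (a + b)%MM = v a + v b)%N -> additive_weight w ->
  additive_weight (fun a => (v a, w a) : (nat *l O)%type).
Proof.
move=> vD wD a b c; rewrite !ltxi_natE !vD ltn_add2r eqn_add2r.
by case/orP => [->//|/andP[-> /wD ->]]; rewrite orbT.
Qed.

Section Estimates.
Context {K : fieldType} {E : smooth_data K} (hE : smooth_category E).
Context {R : realType} {k n m : nat} {T : 'M[R]_(k.+1, n)}.
Hypothesis hT : normalized_grading T.
Context {I : finType} {alpha : I -> 'X_{1..n}} {f : I -> E (n + m)%N}.
Hypothesis alpha_inj : injective alpha.
Hypothesis f_exp : forall x, is_exp T (restrict E n m (f x)) (Some (alpha x)).

(* Putting the degree in [v] first makes [alpha x] the leading exponent of [f x]
   as a germ in [(u, v)]. It remains so with the total degree in front when the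
   order of [f x] is the degree of [alpha x]. *)
Let weight0 (c : 'X_{1..n + m}) : (nat *l k.+1.-tuplelexi R)%type :=
  (mdeg (rpart c), grade T (lpart c)).
Let weight1 (c : 'X_{1..n + m}) : (nat *l (nat *l k.+1.-tuplelexi R))%type :=
  (mdeg c, weight0 c).

Let rpartD (a b : 'X_{1..n + m}) : mdeg (rpart (a + b)%MM) = (mdeg (rpart a) + mdeg (rpart b))%N.
Proof. by rewrite -mdegD; congr mdeg; apply/mnmP => i; rewrite mnmDE !mnmE. Qed.

Let rpart_lext (a : 'X_{1..n}) : mdeg (rpart (lext m a)) = 0%N.
Proof. by apply/eqP; rewrite mdeg_eq0; apply/eqP/mnmP => i; rewrite mnmE lext_r mnm0E. Qed.

Let weight0_wf : wf_weight weight0.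
Proof. apply: (@wf_weight_lexi _ _ _ _ (grade T \o @lpart n m)).
exact: wf_weight_comp (wf_grade hT). Qed.

Let weight0_add : additive_weight weight0.
Proof.
apply: additive_weight_lexi => // a b c; rewrite !lpartD; exact: grade_additive.
Qed.

Let f_lead x : coeff (f x) (lext m (alpha x)) != 0.
Proof. by rewrite -coeff_restrict //; exact: (f_exp x).1. Qed.

Let f_tail x b : coeff (f x) b != 0 -> b <> lext m (alpha x) ->
  (weight0 (lext m (alpha x)) < weight0 b)%O.
Proof.
move=> fb ne; rewrite ltxi_natE rpart_lext lextK.
have [b0|] := posnP (mdeg (rpart b)); last by move=> lt; apply/orP; left.
rewrite b0 /=; have bE := lext_lpart b0.
apply: (f_exp x).2 => [|e]; last by apply: ne; rewrite -bE e.
by rewrite /supp /= -[fcoef _ _]/(coeff _ _) coeff_restrict // bE.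
Qed.

Section Division.
Variables (g r : E (n + m)%N) (h : I -> E (n + m)%N).
Hypothesis gE : g = \sum_x h x * f x + r.
Hypothesis hs : forall x c, supd (h x) c -> sector alpha x (lpart c).
Hypothesis rs : forall c, supd r c -> ~ generated alpha (lpart c).

Let h_disj x x' c c' : coeff (h x) c != 0 -> coeff (h x') c' != 0 ->
  (lext m (alpha x) + c = lext m (alpha x') + c')%MM -> x = x'.
Proof.
move=> /(supd_coeff hE) /hs h1 /(supd_coeff hE) /hs h2 /(congr1 (@lpart n m)).
rewrite !lpartD !lextK; exact: sector_inj h1 h2.
Qed.

Let r_disj x c : coeff (h x) c != 0 -> coeff r (lext m (alpha x) + c)%MM = 0.
Proof.
move=> _; apply/eqP; apply: contrapT => /negP /(supd_coeff hE) /rs; apply.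
by exists x; rewrite lpartD lextK lem_addr.
Qed.

(** The upper set is empty, so all coefficients vanish. *)
Lemma division0_coeff : g = 0 ->
  (forall c, coeff r c = 0) /\ (forall x c, coeff (h x) c = 0).
Proof.
move=> g0; have [||rU hU] := @division_weights _ _ _ _ _ _ _ _ _ _ _ _ weight0_wf weight0_add
  gE f_lead f_tail h_disj r_disj (fun=> False) => //.
  by move=> c; rewrite g0 coeff0 eqxx.
by split=> [c|x c]; apply/eqP; apply: contrapT => /negP; [apply: rU|apply: hU].
Qed.

Lemma division_ord : (forall x, ord R (f x) = ((mdeg (alpha x))%:R)%:E) ->
  forall x, (ord R g - ((mdeg (alpha x))%:R)%:E <= ord R (h x))%E.
Proof.
move=> f_ord x; apply: ord_sub_le => e /(sc_taylor_exp hE) eg.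
apply/(sc_taylor_exp hE) => c; apply: contraTeq => hc; rewrite -leqNgt leq_subLR.
have [|||_ hU] := @division_weights _ _ _ _ _ weight1 _ _ _ _ _ _
    (wf_weight_lexi _ weight0_wf) (additive_weight_lexi (@mdegD _) weight0_add)
    gE f_lead _ h_disj r_disj (fun o => (e <= o.1)%N).
- move=> y b fb ne; rewrite ltxi_natE mdeg_lext.
  have := ord_coeff hE (f_ord y) fb; rewrite leq_eqVlt => /orP[/eqP <-|->//].
  by rewrite eqxx f_tail ?orbT.
- move=> o o'; rewrite leEprodlexi => /andP[oo' _] /leq_trans; apply; exact: oo'.
- by move=> b; apply: contra_neqT; rewrite -ltnNge => /eg.
by have := hU x c hc; rewrite /weight1 /= mdegD mdeg_lext.
Qed.

Let restrict_eq : restrict E n m g = \sum_x restrict E n m (h x) * restrict E n m (f x)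
  + restrict E n m r.
Proof.
rewrite gE rmorphD rmorph_sum; congr (_ + _).
by apply: eq_bigr => x _; rewrite rmorphM.
Qed.

Lemma restrict_weights (U : k.+1.-tuplelexi R -> Prop) :
  (forall o o', (o <= o')%O -> U o -> U o') ->
  (forall c, coeff (restrict E n m g) c != 0 -> U (grade T c)) ->
  forall x c, coeff (restrict E n m (h x)) c != 0 -> U (grade T (alpha x + c)%MM).
Proof.
move=> Uup gU x0 c0 hc0.
have [||||_ hU] := @division_weights _ _ _ _ _ (grade T) _ alpha
  (restrict E n m \o f) (restrict E n m \o h) _ _ (wf_grade hT)
  (grade_additive (T := T)) restrict_eq _ _ _ _ U Uup gU.
- by move=> x; exact: (f_exp x).1.
- by move=> x; exact: (f_exp x).2.
- move=> x x' c c'; rewrite /= !coeff_restrict // => h1 h2 e.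
  by apply: (h_disj h1 h2); rewrite -!lextD e.
- by move=> x c; rewrite /= !coeff_restrict // lextD; apply: r_disj.
exact: hU.
Qed.

Lemma division_ord_restrict x :
  (ord R (restrict E n m g) - ((mdeg (alpha x))%:R)%:E <= ord R (restrict E n m (h x)))%E.
Proof.
apply: ord_sub_le => e /(sc_taylor_exp hE) eg.
apply/(sc_taylor_exp hE) => c; apply: contraTeq => hc; rewrite -leqNgt leq_subLR.
rewrite -mdegD -(Num.Theory.ler_nat R) -(grade_tnth0 hT).
apply: (restrict_weights (U := fun o => (e%:R <= tnth o ord0)%R)) hc => [o o'|b].
  move=> oo' eo; apply: le_trans eo _; rewrite leNgt; apply/negP => lt; move: oo'.
  rewrite leNgt => /negP; apply; apply/ltxi_tuplePlt; exists ord0 => [i|//]; first by rewrite ltn0.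
by rewrite (grade_tnth0 hT) Num.Theory.ler_nat; apply: contra_neqT; rewrite -ltnNge => /eg.
Qed.

Lemma exists_exp (F : E n) : total_grading T -> exists e, is_exp T F e.
Proof.
move=> tot; have [[a Fa]|no] := pselect (supp F !=set0); last first.
  by exists None; apply/seteqP; split=> // a Fa; apply: no; exists a.
have [|b Fb bmin] := wf_grade hT (S := supp F); first by exists a.
exists (Some b); split=> // c Fc cb; rewrite lt_neqAle bmin // andbT.
by apply/eqP => /tot bc; apply: cb.
Qed.

Lemma division_exp x : total_grading T -> exists a b,
  [/\ is_exp T (restrict E n m (h x)) a, is_exp T (restrict E n m g) b
    & exp_le T b (omap (fun c => (c + alpha x)%MM) a)].
Proof.
move=> tot; have [a aP] := exists_exp (restrict E n m (h x)) tot.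
have [b bP] := exists_exp (restrict E n m g) tot.
exists a, b; split=> //; case: a b aP bP => [a|] [b|] //= [ha _] => [[gb bmin]|g0].
  rewrite addmC; apply: (restrict_weights (U := fun o => (grade T b <= o)%O)) ha.
    by move=> o o' oo' /le_trans; apply.
  by move=> c gc; case: (eqVneq c b) => [->//|/eqP ne]; apply/ltW/bmin.
apply: (restrict_weights (U := fun=> False)) ha => // c gc.
by have : supp (restrict E n m g) c by []; rewrite g0.
Qed.

End Division.
End Estimates.

(** * The division theorem *)

Lemma at_level_inj n i i' (a : 'X_{1..n}) : at_level i a -> at_level i' a -> i = i'.
Proof.
wlog: i i' / (i < i')%N => [hw|lt] [ai ai1] [ai' ai'1].
  by case: (ltngtP i i') => // lt; [|apply/esym]; apply: hw.
have i'0 : (0 < i')%N by apply: leq_ltn_trans lt.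
by case: (ai'1 i'0); apply: in_Npow_leq ai; rewrite -ltnS prednK.
Qed.

Theorem theorem5p1p1 (K : fieldType) (E : smooth_data K)
    (hE : smooth_category E) (R : realType) (n m k : nat)
    (T : 'M[R]_(k.+1, n)) (hT : normalized_grading T)
    (s : 'I_n.+1 -> nat) (f : forall i, 'I_(s i) -> E (n + m)%N)
    (alpha : forall i, 'I_(s i) -> 'X_{1..n})
    (halpha : forall i (j : 'I_(s i)),
       is_exp T (restrict E n m (f i j)) (Some (alpha i j)))
    (hlevel : forall i (j : 'I_(s i)), at_level i (alpha i j))
    (hsorted : forall i (j j' : 'I_(s i)),
       (j < j')%N -> revlex_lt (alpha i j) (alpha i j'))
    (hfinite : finite_type (diagram alpha)) :
  (forall g : E (n + m)%N, exists h r, is_decomposition f alpha g h r) /\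
  (reduced E ->
     forall (g : E (n + m)%N) h r h' r',
       is_decomposition f alpha g h r -> is_decomposition f alpha g h' r' ->
       (forall i j, h i j = h' i j) /\ r = r') /\
  (forall (g : E (n + m)%N) h r, is_decomposition f alpha g h r ->
     [/\ (forall i (j : 'I_(s i)),
            ord R (f i j) = ((mdeg (alpha i j))%:R)%:E) ->
         forall i (j : 'I_(s i)),
            (ord R g - ((mdeg (alpha i j))%:R)%:E <= ord R (h i j))%E,
         total_grading T ->
         forall i (j : 'I_(s i)), exists a b,
            [/\ is_exp T (restrict E n m (h i j)) a,
                is_exp T (restrict E n m g) b
              & exp_le T b (omap (fun c => (c + alpha i j)%MM) a)]
       & forall i (j : 'I_(s i)),
            (ord R (restrict E n m g) - ((mdeg (alpha i j))%:R)%:E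
             <= ord R (restrict E n m (h i j)))%E]).
Proof.
pose I := {i : 'I_n.+1 & 'I_(s i)}.
pose mk i (j : 'I_(s i)) : I := Tagged (fun i => 'I_(s i)) j.
pose alphaI (x : I) := alpha (tag x) (tagged x).
pose fI (x : I) := f (tag x) (tagged x).
have alpha_inj : injective alphaI.
  move=> [i j] [i' j']; rewrite /alphaI /= => e.
  have ii' : i = i'.
    by apply/val_inj/(at_level_inj (hlevel i j)); rewrite e; apply: hlevel.
  case: i' / ii' j' e => j' e; congr existT.
  have irr a : ~ revlex_lt a a by rewrite /revlex_lt ltxx.
  apply: contrapT => /eqP jj'.
  case: (ltngtP j j') => [/hsorted|/hsorted|/val_inj/eqP]; rewrite ?e; [exact: irr|exact: irr|].
  by rewrite (negPf jj').
have genE : generated alphaI = diagram alpha.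
  by apply/seteqP; split=> [b [[i j] h]|b [i [j h]]]; [exists i, j|exists (mk _ j)].
have sectorE i j : sector alphaI (mk _ j) = Gamma_ij alpha (i := i) j.
  apply/seteqP; split=> [c h|c [_ h] [i' j'] /h //].
  by split=> [|i' j' lt]; [exact: lem_addr|apply: (h (Tagged _ j'))].
have f_exp x : is_exp T (restrict E n m (fI x)) (Some (alphaI x)) by apply: halpha.
have fin : finite_type (generated alphaI) by rewrite genE.
pose hI (h : forall i, 'I_(s i) -> E (n + m)%N) (x : I) := h (tag x) (tagged x).
have sumE (F : forall i, 'I_(s i) -> E (n + m)%N) :
    \sum_(i < n.+1) \sum_(j < s i) F i j = \sum_(x : I) F (tag x) (tagged x).
  by rewrite (@sig_big_dep _ _ _ _ (fun i => 'I_(s i)) xpredT (fun=> xpredT) F).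
have decE g h r : is_decomposition f alpha g h r -> [/\ g = \sum_x hI h x * fI x + r,
    forall x c, supd (hI h x) c -> sector alphaI x (lpart c)
  & forall c, supd r c -> ~ generated alphaI (lpart c)].
  move=> [-> hs rs]; split.
  - by rewrite sumE.
  - by move=> [i j] c /hs; rewrite sectorE.
  - by move=> c /rs; rewrite genE.
split; last split.
- move=> g; have [h [r [gE hs _ rs]]] :=
    partial_division_exists hE hT alpha_inj f_exp fin g (leqnn n).
  exists (fun i j => h (mk _ j)), r; split.
  + by rewrite gE (sumE (fun i j => h (mk i j) * f i j)); congr (_ + _); apply: eq_bigr => -[].
  + by move=> i j c /hs; rewrite sectorE.
  + by move=> c /rs; rewrite trunc_ge // genE.
- move=> red g h r h' r' /decE [gE hs rs] /decE [gE' hs' rs'].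
  have [|||r0 h0] := division0_coeff hE hT alpha_inj f_exp
      (h := fun x => hI h x - hI h' x) (r := r - r') _ _ _ (erefl 0).
  + under eq_bigr => x _ do rewrite mulrBl.
    by rewrite sumrB addrACA -gE -opprD -gE' subrr.
  + by move=> x c /supdB[/hs|/hs'].
  + by move=> c /supdB[/rs|/rs'].
  split=> [i j|]; apply/eqP; rewrite -subr_eq0; apply/eqP; apply: (reduced_eq0 hE red) => //.
  exact: (h0 (mk _ j)).
- move=> g h r /decE [gE hs rs]; split.
  + move=> f_ord i j.
    exact: (division_ord hE hT alpha_inj f_exp gE hs rs (fun x => f_ord _ _) (mk _ j)).
  + move=> tot i j.
    exact: (division_exp hE hT alpha_inj f_exp gE hs rs (mk _ j) tot).
  + move=> i j.
    exact: (division_ord_restrict hE hT alpha_inj f_exp gE hs rs (mk _ j)).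
Qed.
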